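(* Let $n,k$ be integers with $1\le k<n$, and let $K$ and $L$ be two bounded Borel sets in $\mathbb{R}^n$ such that $L\subset K$. Let $\mu$ be a measure in $\mathbb{R}^n$ with bounded non-negative (Borel) measurable density $g$, where $\|g\|_\infty>0$. Then $$\big(\mu(K)-\mu(L)\big)^{\frac{n-k}{n}}\ge c_{n,k}^k\,\frac{1}{\|g\|_\infty^{\frac kn}}\left(\int_{{\rm Gr}_{n-k}}\big(\mu(K\cap F)-\mu(L\cap F)\big)^{\frac{n}{n-k}}\,d\nu_{n,n-k}(F)\right)^{\frac{n-k}{n}},$$ where $\nu_{n,n-k}$ is the Haar probability measure on ${\rm Gr}_{n-k}$. In particular, $$\big(\mu(K)-\mu(L)\big)^{\frac{n-k}{n}}\ge c_{n,k}^k\,\frac{1}{\|g\|_\infty^{\frac kn}}\,\inf_{F\in{\rm Gr}_{n-k}}\big(\mu(K\cap F)-\mu(L\cap F)\big).$$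
   Context: ${\rm Gr}_{n-k}$ is the Grassmannian of $(n-k)$-dimensional linear subspaces of $\mathbb{R}^n$, $\omega_m$ is the volume of the unit Euclidean ball in $\mathbb{R}^m$, and $c_{n,k}^k=\omega_n^{\frac{n-k}{n}}/\omega_{n-k}$. For the measure $\mu$ with density $g$, $\mu(B)=\int_B g$ for Borel $B\subset\mathbb{R}^n$, and for $F\in{\rm Gr}_{n-k}$ one writes $\mu(B\cap F)=\int_{B\cap F}g$, where the restriction of the function $g$ to $F$ is integrated against Lebesgue measure on $F$. $\|g\|_\infty$ is the $L_\infty$ norm of $g$ on $\mathbb{R}^n$. *)

(* Defs.v *)
From HB Require Import structures.
From mathcomp Require Import all_boot all_order all_algebra perm.
From mathcomp Require Import all_classical all_reals all_analysis measurable_realfun.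

Set Implicit Arguments.
Unset Strict Implicit.
Unset Printing Implicit Defensive.

Import Order.TTheory GRing.Theory Num.Theory.
Import numFieldNormedType.Exports.

Local Open Scope classical_set_scope.
Local Open Scope ring_scope.

(* Vectors of R^n are rows 'rV[R]_n, and the rows of an m x n matrix are m
   vectors of R^n.  The measurable sets of 'M[R]_(m, n) are the Borel sets. *)
Section borel_matrix.
Variables (R : realType) (m n : nat).

HB.instance Definition _ := @isMeasurable.Build
  (sigma_display (@open 'M[R]_(m, n))) 'M[R]_(m, n) <<s @open 'M[R]_(m, n) >>
  (@sigma_algebra0 _ setT _) (@sigma_algebraC _ _)
  (@sigma_algebra_bigcup _ setT _).

Lemma open_measurable_mx (U : set 'M[R]_(m, n)) : open U -> measurable U.
Proof. exact: sub_sigma_algebra. Qed.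

Lemma coord_measurable_mx i j :
  measurable_fun setT (fun A : 'M[R]_(m, n) => A i j : measurableTypeR R).
Proof.
apply: (measurability _ (RGenOpens.measurableE R)).
move=> _ [_ [a [b ->] <-]]; rewrite setTI; apply: open_measurable_mx.
by move/continuousP: (@coord_continuous R m n i j); apply; exact: interval_open.
Qed.

Let box (p : 'M[rat]_(m, n) * nat) : set 'M[R]_(m, n) :=
  [set A | forall i j, ball (ratr (p.1 i j) : R) p.2.+1%:R^-1 (A i j)].

Let open_box (U : set 'M[R]_(m, n)) : open U ->
  U = \bigcup_(p in [set p | box p `<=` U]) box p.
Proof.
move=> oU; apply/seteqP; split=> [A UA|A [p pU]]; last exact: pU.
have /nbhs_ballP[e /= e0 eU] := open_nbhs_nbhs (conj oU UA).
have e20 : 0 < e / 2 by rewrite divr_gt0.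
near \oo => k.
have ke : k.+1%:R^-1 < e / 2 :> R.
  by near: k; exact: (near_infty_natSinv_lt (PosNum e20)).
have k0 : 0 < k.+1%:R^-1 :> R by rewrite invr_gt0.
have /choice[q qA] (ij : 'I_m * 'I_n) :
    exists q : rat, ball (ratr q : R) k.+1%:R^-1 (A ij.1 ij.2).
  have /rat_in_itvoo[q] :
      A ij.1 ij.2 - k.+1%:R^-1 < A ij.1 ij.2 + k.+1%:R^-1.
    by rewrite ltrD2l (lt_trans _ k0)// oppr_lt0.
  rewrite in_itv/= => qA; exists q; apply: ball_sym.
  by rewrite /ball/= ltr_distlC.
exists (\matrix_(i, j) q (i, j), k) => /=; last first.
  by move=> i j; rewrite mxE; exact: (qA (i, j)).
move=> B /= qB; apply: eU; split=> // i j.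
rewrite /ball/= (le_lt_trans (ler_distD (ratr (q (i, j))) _ _))//.
rewrite (splitr e) ltrD// (lt_trans _ ke)//; first by rewrite distrC; exact: (qA (i, j)).
by have := qB i j; rewrite mxE.
Unshelve. all: by end_near. Qed.

Lemma measurable_mx_coord d (T : measurableType d) (f : T -> 'M[R]_(m, n)) :
  (forall i j, measurable_fun setT (fun t => f t i j : measurableTypeR R)) ->
  measurable_fun setT f.
Proof.
move=> mf; apply: (measurability (@open 'M[R]_(m, n))) => //.
move=> _ [U oU <-]; rewrite setTI (open_box oU) preimage_bigcup bigcup_mkcond.
apply: countable_bigcupT_measurable; first exact: countableP.
move=> p; case: ifPn => // _.
rewrite (_ : _ @^-1` _ = \bigcap_(ij in [set: 'I_m * 'I_n]) (setT `&`
  (fun t => f t ij.1 ij.2 : measurableTypeR R) @^-1`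
    ball (ratr (p.1 ij.1 ij.2) : R) p.2.+1%:R^-1)); last first.
  apply/seteqP; split=> t /= H; first by move=> ij _; split => //; exact: H.
  by move=> i j; have [] := H (i, j) I.
apply: fin_bigcap_measurable => // ij _; apply: mf => //.
by apply: open_measurable; apply: ball_open; rewrite invr_gt0.
Qed.

End borel_matrix.

Lemma continuous_measurable_mx (R : realType) m n p q
    (f : 'M[R]_(m, n) -> 'M[R]_(p, q)) :
  continuous f -> measurable_fun setT f.
Proof.
move=> /continuousP cf; apply: (measurability (@open 'M[R]_(p, q))) => //.
move=> _ [U oU <-]; rewrite setTI.
by apply: open_measurable_mx; exact: cf.
Qed.

Section image_measure.
Context d1 d2 (T1 : measurableType d1) (T2 : measurableType d2) (R : realType).
Variables (mu : {measure set T1 -> \bar R}) (f : {mfun T1 >-> T2}).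

Definition image_measure : set T2 -> \bar R := pushforward mu f.

Let image0 : image_measure set0 = 0%E. Proof. exact: measure0. Qed.

Let image_ge0 A : (0 <= image_measure A)%E. Proof. exact: measure_ge0. Qed.

Let image_sigma_additive : semi_sigma_additive image_measure.
Proof. exact: measure_semi_sigma_additive. Qed.

HB.instance Definition _ := isMeasure.Build _ _ _ image_measure
  image0 image_ge0 image_sigma_additive.

End image_measure.

Section lebesgue_rV.
Variable R : realType.

Definition row_cons n (x : measurableTypeR R * 'rV[R]_n) : 'rV[R]_n.+1 :=
  row_mx x.1%:M x.2.

Let row_cons_measurable n : measurable_fun setT (@row_cons n).
Proof.
apply: measurable_mx_coord => i j; rewrite ord1 {i}.
case: (@splitP 1 n j) => j' jj'.
  rewrite (_ : (fun _ => _) = fst); first exact: measurable_fst.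
  apply/funext => x; rewrite /row_cons (_ : j = lshift n j'); last exact: val_inj.
  by rewrite (@row_mxEl R 1 1 n) mxE ord1 eqxx.
rewrite (_ : (fun _ => _) = (fun v : 'rV_n => v ord0 j' : measurableTypeR R) \o snd).
  by apply: measurableT_comp; [exact: coord_measurable_mx|exact: measurable_snd].
apply/funext => x; rewrite /row_cons (_ : j = rshift 1 j'); last exact: val_inj.
by rewrite (@row_mxEr R 1 1 n).
Qed.

HB.instance Definition _ n := isMeasurableFun.Build _ _ _ _ (@row_cons n)
  (@row_cons_measurable n).

Section step.
Variables (n : nat) (mu : {sigma_finite_measure set 'rV[R]_n -> \bar R}).

Definition lebesgue_rV_step : set 'rV[R]_n.+1 -> \bar R :=
  image_measure ((@lebesgue_measure R) \x mu)%E (@row_cons n).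

HB.instance Definition _ := Measure.on lebesgue_rV_step.

Let row_uncons (v : 'rV[R]_(1 + n)) : measurableTypeR R * 'rV[R]_n :=
  (lsubmx v ord0 ord0, rsubmx v).

Let row_uncons_measurable : measurable_fun setT (row_uncons : 'rV_n.+1 -> _).
Proof.
apply: measurable_fun_pair => /=.
  rewrite (_ : (fun _ => _) = fun v : 'rV_n.+1 => v ord0 (@lshift 1 n ord0) : measurableTypeR R).
    exact: coord_measurable_mx.
  by apply/funext => v; rewrite mxE.
apply: measurable_mx_coord => i j.
rewrite (_ : (fun _ => _) = fun v : 'rV_n.+1 => v i (@rshift 1 n j) : measurableTypeR R).
  exact: coord_measurable_mx.
by apply/funext => v; rewrite mxE.
Qed.

Let row_consK : cancel (@row_cons n) row_uncons.
Proof.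
by move=> [x v]; rewrite /row_uncons /row_cons row_mxKl row_mxKr !mxE eqxx.
Qed.

Let lebesgue_rV_step_sigma_finite : sigma_finite setT lebesgue_rV_step.
Proof.
have /sigma_finiteP[F [TF ndF Foo]] := sigma_finiteT (@lebesgue_measure R).
have /sigma_finiteP[G [TG ndG Goo]] := sigma_finiteT mu.
exists (fun i => row_uncons @^-1` (F i `*` G i)).
  rewrite -preimage_bigcup (_ : \bigcup_i _ = setT) ?preimage_setT//.
  apply/seteqP; split=> // -[x y] _.
  have : [set: measurableTypeR R] x by []. rewrite TF => -[i _ Fx].
  have : [set: 'rV[R]_n] y by []. rewrite TG => -[j _ Gy].
  exists (maxn i j) => //; split => /=.
    by move: x Fx; exact/subsetPset/ndF/leq_maxl.
  by move: y Gy; exact/subsetPset/ndG/leq_maxr.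
move=> i; have [mF Fi] := Foo i; have [mG Gi] := Goo i; split.
  rewrite -[X in measurable X]setTI; apply: row_uncons_measurable => //.
  exact: measurableX.
rewrite /lebesgue_rV_step /image_measure /pushforward -comp_preimage.
rewrite (_ : row_uncons \o _ = id); last first.
  by apply/funext => x /=; rewrite row_consK.
rewrite preimage_id [ltLHS](product_measure1E (@lebesgue_measure R) mu mF mG).
by rewrite lte_mul_pinfty// ge0_fin_numE.
Qed.

HB.instance Definition _ := @Measure_isSigmaFinite.Build _ _ _
  lebesgue_rV_step lebesgue_rV_step_sigma_finite.

End step.

(* R^(n+1) is R x R^n with the product measure; R^0 is a point of mass 1. *)
Fixpoint lebesgue_rV n : {sigma_finite_measure set 'rV[R]_n -> \bar R} :=
  if n is n'.+1 then lebesgue_rV_step (lebesgue_rV n')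
  else \d_(0 : 'rV[R]_0).

Lemma lebesgue_rV_box n (A : 'I_n -> set (measurableTypeR R)) :
  (forall i, measurable (A i)) ->
  lebesgue_rV n [set x | forall i, A i (x 0 i)] =
    (\prod_(i < n) lebesgue_measure (A i))%E.
Proof.
elim: n A => [|n IH] A mA.
  rewrite big_ord0 (_ : mkset _ = setT) /= ?diracT//.
  by apply/funext => x; apply/propext; split=> // _ [].
rewrite big_ord_recl -IH => [|i]; last exact: mA.
have mB : measurable [set x : 'rV[R]_n | forall i, A (lift ord0 i) (x 0 i)].
  rewrite (_ : mkset _ = \bigcap_(i in [set: 'I_n])
    (setT `&` (fun x : 'rV[R]_n => x 0 i : measurableTypeR R) @^-1`
      A (lift ord0 i))).
    apply: fin_bigcap_measurable => // i _.
    by apply: coord_measurable_mx => //; exact: mA.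
  apply/funext => x; apply/propext; split=> /= [Ax i _|Ax i].
    by split => //; exact: Ax.
  by have [] := Ax i I.
rewrite -(product_measure1E (@lebesgue_measure R) (lebesgue_rV n) (mA ord0) mB).
rewrite [LHS]/= /lebesgue_rV_step /image_measure /pushforward.
congr (product_measure1 _ _ _).
have E0 (x : measurableTypeR R * 'rV[R]_n) : row_cons x 0 ord0 = x.1.
  transitivity (row_mx (x.1%:M : 'M[R]_1) x.2 0 (@lshift 1 n ord0)).
    by congr (row_mx _ _ _ _); exact: val_inj.
  by rewrite (@row_mxEl R 1 1 n) mxE eqxx.
have ES (x : measurableTypeR R * 'rV[R]_n) i : row_cons x 0 (lift ord0 i) = x.2 0 i.
  transitivity (row_mx (x.1%:M : 'M[R]_1) x.2 0 (@rshift 1 n i)).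
    by congr (row_mx _ _ _ _); exact: val_inj.
  by rewrite (@row_mxEr R 1 1 n).
apply/seteqP; split=> x /= Ax.
  split; first by rewrite -E0; exact: Ax.
  by move=> i; rewrite -ES; exact: Ax.
move=> i; have [->|i0] := eqVneq i ord0; first by rewrite E0; case: Ax.
have [j ->] : exists j, i = lift ord0 j.
  by case: (unliftP ord0 i) i0 => [j ->|->]; [exists j|rewrite eqxx].
by rewrite ES; case: Ax.
Qed.

End lebesgue_rV.

Section frames.
Variable R : realType.

Definition rowspan m n (A : 'M[R]_(m, n)) : {vspace 'rV[R]_n} :=
  limg (linfun (mulmxr A : 'rV[R]_m -> 'rV[R]_n)).

Lemma rowspanP m n (A : 'M[R]_(m, n)) (x : 'rV[R]_n) :
  reflect (exists y : 'rV[R]_m, x = y *m A) (x \in rowspan A).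
Proof.
apply: (iffP memv_imgP) => [[y _ ->]|[y ->]]; first by exists y; rewrite lfunE.
by exists y; rewrite ?memvf// lfunE.
Qed.

Lemma mul_tr_row_eq0 n (x : 'rV[R]_n) : x *m x^T = 0 -> x = 0.
Proof.
move=> /matrixP/(_ 0 0); rewrite !mxE => /psumr_eq0P xx.
apply/rowP => i; rewrite mxE; apply/eqP; rewrite -sqrf_eq0 expr2.
have := xx _ i isT; rewrite mxE => -> // j _.
by rewrite mxE -expr2 sqr_ge0.
Qed.

Lemma dim_rowspan m n (A : 'M[R]_(m, n)) :
  (\dim (rowspan A) == m) = (\det (A *m A^T) != 0).
Proof.
have := limg_ker_dim (linfun (mulmxr A : 'rV[R]_m -> 'rV[R]_n)) fullv.
rewrite capfv [in RHS]dimvf/= /dim/= mul1n => dimE.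
rewrite -[X in _ == X]dimE -{1}[\dim (rowspan A)]add0n eqn_add2r eq_sym dimv_eq0.
apply/idP/idP => [/eqP ker0|detA].
  apply/negP => /det0P[x x0 xAA]; move/negP: x0; apply.
  rewrite -memv0 -ker0 memv_ker lfunE/=; apply/eqP/mul_tr_row_eq0.
  by rewrite trmx_mul mulmxA -[x *m A *m A^T]mulmxA xAA mul0mx.
rewrite -subv0; apply/subvP => x; rewrite memv_ker lfunE/= memv0 => /eqP xA.
have AA : A *m A^T \in unitmx by rewrite unitmxE unitfE.
by rewrite -[x](mulmxK AA) mulmxA xA !mul0mx.
Qed.

Lemma continuous_gram m n :
  continuous (fun A : 'M[R]_(m, n) => \det (A *m A^T)).
Proof.
rewrite (_ : (fun A : 'M[R]_(m, n) => _) = fun A => \sum_(s : 'S_m)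
    (-1) ^+ s * \prod_i \sum_j A i j * A (s i) j); last first.
  apply/funext => A; apply: eq_bigr => s _; congr (_ * _).
  by apply: eq_bigr => i _; rewrite mxE; apply: eq_bigr => j _; rewrite mxE.
have sum_continuous I (F : I -> 'M[R]_(m, n) -> R) (r : seq I) :
    (forall i, continuous (F i)) -> continuous (fun A => \sum_(i <- r) F i A).
  by move=> cF; apply: continuous_big => //; exact: add_continuous.
have prod_continuous I (F : I -> 'M[R]_(m, n) -> R) (r : seq I) :
    (forall i, continuous (F i)) -> continuous (fun A => \prod_(i <- r) F i A).
  by move=> cF; apply: continuous_big => //; exact: mul_continuous.
have coord i j : continuous (fun A : 'M[R]_(m, n) => A i j).
  exact: (@coord_continuous R m n i j).
have gram_continuous (s : 'S_m) : continuous
    (fun A : 'M[R]_(m, n) => \prod_i \sum_j A i j * A (s i) j).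
  apply: prod_continuous => i; apply: sum_continuous => j A.
  exact: cvgM (coord i j A) (coord (s i) j A).
apply: sum_continuous => s A; exact: cvgM (cvg_cst _) (gram_continuous s A).
Qed.

Lemma full_rank_open m n :
  open [set A : 'M[R]_(m, n) | \dim (rowspan A) = m].
Proof.
rewrite (_ : mkset _ = [set A | \det (A *m A^T) != 0]); last first.
  apply/funext => A; apply/propext => /=.
  by rewrite -dim_rowspan; split=> [/eqP|/eqP].
apply: (@open_comp _ _ (fun A : 'M[R]_(m, n) => \det (A *m A^T))
  [set x | x != 0]) => [A _|]; last exact: open_neq.
exact: continuous_gram.
Qed.

Lemma orthonormal_frame_exists n m (F : {vspace 'rV[R]_n}) : \dim F = m ->
  exists U : 'M[R]_(m, n), U *m U^T = 1%:M /\ rowspan U = F.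
Proof.
elim: m F => [|m IH] F dimF.
  exists 0; split; first by apply/matrixP => -[].
  move/eqP: dimF; rewrite dimv_eq0 => /eqP ->; apply/vspaceP => x.
  rewrite memv0; apply/rowspanP/eqP => [[y ->]|->]; first by rewrite mulmx0.
  by exists 0; rewrite mulmx0.
pose v := vpick F; pose c := \sum_i v 0 i ^+ 2.
have v0 : v != 0 by rewrite vpick0 -dimv_eq0 dimF.
have c0 : 0 < c.
  rewrite lt_neqAle sumr_ge0 ?andbT; last by move=> i _; rewrite sqr_ge0.
  apply: contra v0; rewrite eq_sym => /eqP/psumr_eq0P c0.
  apply/eqP/rowP => i; rewrite mxE; apply/eqP; rewrite -sqrf_eq0.
  by rewrite c0// => j _; rewrite sqr_ge0.
pose u := (Num.sqrt c)^-1 *: v.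
have uF : u \in F by rewrite memvZ// memv_pick.
have uu : u *m u^T = 1%:M.
  rewrite linearZ/= -scalemxAl -scalemxAr scalerA -expr2 exprVn sqr_sqrtr ?ltW//.
  apply/matrixP => i j; rewrite !ord1 !mxE (eq_bigr (fun i => v 0 i ^+ 2)).
    by rewrite mulVf// gt_eqF.
  by move=> l _; rewrite mxE expr2.
pose f := linfun (mulmxr u^T : 'rV[R]_n -> 'M[R]_1).
have fE x : f x = x *m u^T by rewrite lfunE.
have dimfF : \dim (f @: F) = 1%N.
  apply/eqP; rewrite eqn_leq; apply/andP; split.
    by rewrite (leq_trans (dimvS (subvf _)))// dimvf/= /dim/= mul1n.
  rewrite lt0n dimv_eq0; apply/eqP => fF0.
  have := memv_img f uF; rewrite fF0 memv0 fE uu => /eqP/matrixP/(_ 0 0)/eqP.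
  by rewrite !mxE oner_eq0.
have [|U [UU spanU]] := IH (F :&: lker f)%VS.
  by apply/eqP; rewrite -eqSS -dimF -(limg_ker_dim f F) dimfF addn1.
have Uu : U *m u^T = 0.
  apply/row_matrixP => i; rewrite row_mul row0 -fE; apply/eqP.
  rewrite -memv_ker; have : row i U \in rowspan U.
    by apply/rowspanP; exists (delta_mx 0 i); rewrite rowE.
  by rewrite spanU memv_cap => /andP[].
have uU : u *m U^T = 0 by rewrite -[LHS]trmxK trmx_mul trmxK Uu trmx0.
suff [W] : exists W : 'M[R]_(1 + m, n), W *m W^T = 1%:M /\ rowspan W = F.
  by exists W.
exists (col_mx u U); split.
  by rewrite tr_col_mx mul_col_row uu uU Uu UU -scalar_mx_block.
apply/vspaceP => x; apply/rowspanP/idP => [[y ->]|xF].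
  rewrite -[y]hsubmxK mul_row_col memvD//.
    by rewrite [lsubmx _]mx11_scalar mul_scalar_mx memvZ.
  have : rsubmx y *m U \in rowspan U.
    by apply/rowspanP; eexists.
  by rewrite spanU memv_cap => /andP[].
have /rowspanP[z xz] : x - f x *m u \in rowspan U.
  rewrite spanU memv_cap memvB//=; last first.
    by rewrite [f x]mx11_scalar mul_scalar_mx memvZ.
  by rewrite memv_ker linearB/= !fE -mulmxA uu mulmx1 subrr.
exists (row_mx (f x) z).
by rewrite mul_row_col -xz addrC subrK.
Qed.

End frames.

Section grassmannian.
Variables (R : realType) (n k : nat).

(* Indexing by the codimension k makes this type inhabited for all n and k. *)
Definition Gr : Type := {F : {vspace 'rV[R]_n} | \dim F == (n - k)%N}.

HB.instance Definition _ := SubChoice.on Gr.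

Definition Gr_vspace (F : Gr) : {vspace 'rV[R]_n} := val F.
Coercion Gr_vspace : Gr >-> space.

Lemma dim_Gr (F : Gr) : \dim F = (n - k)%N. Proof. exact/eqP/(valP F). Qed.

Let Gr_inhabited : {F : {vspace 'rV[R]_n} | \dim F == (n - k)%N}.
Proof.
pose X := take (n - k) (vbasis {:'rV[R]_n}).
exists <<X>>%VS; have /eqP -> : free X.
  apply: (@catl_free _ _ (drop (n - k) (vbasis {:'rV[R]_n}))).
  by rewrite cat_take_drop (basis_free (vbasisP _)).
rewrite size_take size_tuple dimvf /dim/= mul1n.
by case: ltnP => // nk; rewrite eqn_leq nk leq_subr.
Qed.

HB.instance Definition _ := isPointed.Build Gr Gr_inhabited.

(* The quotient topology: a set of subspaces is open when the set of the bases
   (A_1, ..., A_(n-k)) that span one of its elements is open. *)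
Definition Gr_open (U : set Gr) : Prop :=
  open [set A : 'M[R]_(n - k, n) | exists2 F, U F & rowspan A = F].

Let Gr_openT : Gr_open setT.
Proof.
rewrite /Gr_open (_ : mkset _ = [set A | \dim (rowspan A) = (n - k)%N]).
  exact: full_rank_open.
apply/seteqP; split=> A /= => [[F _ ->]|dimA]; first exact: dim_Gr.
by exists (exist _ (rowspan A) (introT eqP dimA)).
Qed.

Let Gr_openI : setI_closed Gr_open.
Proof.
move=> U V oU oV; have := openI oU oV; rewrite /Gr_open; congr open.
apply/seteqP; split=> A /=.
  move=> [[F UF AF] [G VG AG]]; exists F => //; split=> //.
  by rewrite (_ : F = G)//; apply: val_inj; exact: etrans (esym AF) AG.
by move=> [F [UF VF] AF]; split; exists F.
Qed.

Let Gr_open_bigcup (I : Type) (f : I -> set Gr) :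
  (forall i, Gr_open (f i)) -> Gr_open (\bigcup_i f i).
Proof.
move=> of_; have := @bigcup_open _ I setT _ (fun i _ => of_ i).
rewrite /Gr_open; congr open; apply/seteqP; split=> A /=.
  by move=> [i _ [F fF AF]]; exists F => //; exists i.
by move=> [F [i _ fF] AF]; exists i => //; exists F.
Qed.

HB.instance Definition _ := isOpenTopological.Build Gr
  Gr_openT Gr_openI Gr_open_bigcup.

HB.instance Definition _ := @isMeasurable.Build
  (sigma_display (@open Gr)) Gr <<s @open Gr >>
  (@sigma_algebra0 _ setT _) (@sigma_algebraC _ _)
  (@sigma_algebra_bigcup _ setT _).

Definition orthogonal_mx (T : 'M[R]_n) : Prop := T *m T^T = 1%:M.

(* The image of F under x |-> x T; the default value F of insubd is never used
   for an invertible T. *)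
Definition Gr_act (T : 'M[R]_n) (F : Gr) : Gr :=
  insubd F (linfun (mulmxr T : 'rV[R]_n -> 'rV[R]_n) @: F)%VS.

Lemma Gr_actE (T : 'M[R]_n) (F : Gr) : orthogonal_mx T ->
  Gr_act T F = (linfun (mulmxr T : 'rV[R]_n -> 'rV[R]_n) @: F)%VS :> {vspace _}.
Proof.
move=> TT; rewrite /Gr_vspace /Gr_act insubdK// -topredE/= limg_dim_eq ?(valP F)//.
apply/eqP; rewrite -subv0; apply/subvP => x; rewrite memv_cap memv_ker lfunE/=.
move=> /andP[_ /eqP xT]; rewrite memv0.
by rewrite -[x]mulmx1 -TT mulmxA xT mul0mx.
Qed.

(* The Haar probability measure on the Grassmannian is the unique Borel
   probability measure invariant under the orthogonal group. *)
Definition is_haar (nu : set Gr -> \bar R) : Prop :=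
  forall (T : 'M[R]_n) (A : set Gr), orthogonal_mx T -> measurable A ->
    nu (Gr_act T @^-1` A) = nu A.

Definition orthonormal_frame (F : Gr) : 'M[R]_(n - k, n) :=
  sval (cid (orthonormal_frame_exists (dim_Gr F))).

Lemma orthonormal_frameP (F : Gr) :
  orthonormal_frame F *m (orthonormal_frame F)^T = 1%:M /\
  rowspan (orthonormal_frame F) = F.
Proof. exact: svalP (cid (orthonormal_frame_exists (dim_Gr F))). Qed.

Definition Gr_isometry (F : Gr) (y : 'rV[R]_(n - k)) : 'rV[R]_n :=
  y *m orthonormal_frame F.

Let Gr_isometry_measurable (F : Gr) : measurable_fun setT (Gr_isometry F).
Proof.
apply: measurable_mx_coord => i j.
rewrite (_ : (fun _ => _) =
    fun y : 'rV[R]_(n - k) => \sum_l (y i l : measurableTypeR R) * orthonormal_frame F l j).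
  apply: measurable_sum => l; apply: measurable_funM => //.
  exact: coord_measurable_mx.
by apply/funext => y; rewrite mxE.
Qed.

HB.instance Definition _ (F : Gr) := isMeasurableFun.Build _ _ _ _
  (Gr_isometry F) (@Gr_isometry_measurable F).

(* Lebesgue measure on F, as a measure on R^n carried by F: the image of the
   Lebesgue measure of R^(n-k) under a linear isometry onto F. *)
Definition lebesgue_Gr (F : Gr) : {measure set 'rV[R]_n -> \bar R} :=
  image_measure (lebesgue_rV R (n - k)) (Gr_isometry F).

End grassmannian.

Section volumes.
Variable R : realType.

Definition omega m : R :=
  fine (lebesgue_rV R m [set x | \sum_i x 0 i ^+ 2 <= 1]).

(* The k-th power of the constant c_(n,k). *)
Definition c_pow_k (n k : nat) : R :=
  omega n `^ ((n - k)%N%:R / n%:R) / omega (n - k).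

(* 'N[mu]_+oo is the essential supremum of the absolute value. *)
Definition Linf_norm n (g : 'rV[R]_n -> R) : R :=
  fine 'N[lebesgue_rV R n]_+oo[EFin \o g]%E.

(* The measure with density g and its sections, with real values: the integrals
   are finite for bounded B and bounded g. *)
Definition density_measure n (g : 'rV[R]_n -> R) (B : set 'rV[R]_n) : R :=
  \int[lebesgue_rV R n]_(x in B) g x.

Definition section_measure n k (g : 'rV[R]_n -> R) (B : set 'rV[R]_n)
    (F : Gr R n k) : R :=
  \int[lebesgue_Gr F]_(x in B `&` [set x | x \in (F : {vspace 'rV[R]_n})]) g x.

End volumes.

(* Main.v *)
From HB Require Import structures.
Require Import Defs.
From mathcomp Require Import all_boot all_order all_algebra.
From mathcomp Require Import all_classical all_reals all_analysis measurable_realfun ess_sup_inf.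
From mathcomp Require Import ring lra.

Import Order.TTheory GRing.Theory Num.Theory.
Import numFieldNormedType.Exports.

Local Open Scope classical_set_scope.
Local Open Scope ring_scope.

Set Implicit Arguments.
Unset Strict Implicit.
Unset Printing Implicit Defensive.

(** The inequality follows from a comparison of moments.  Put m = n - k, let f be
    the density g restricted to K minus L, let M be the essential supremum of g,
    and let s(F) be the integral of f over F in the Grassmannian.

    On one subspace F, among all densities bounded by M with integral s(F), the
    moment of order k, the integral of |x|^k f over F, is least for M times the
    indicator function of a centered ball.  The homogeneity of moments of balls
    then gives (lemma [bathtub])
      M kappa (s(F) / (M omega_m))^(n/m) <= the integral of |x|^k f over F,
    where kappa is the moment of the unit ball of R^m.

    The average over F of the right-hand side is (kappa / omega_n) times the
    integral of f over R^n: this is the polar coordinate formula for subspaces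
    ([integral_haar_moment]).  The constant kappa cancels, and raising to the
    power m/n gives the theorem.

    The polar coordinate formula rests on uniqueness arguments that need no
    Jacobian.  A functional invariant under translations is a multiple of the
    Lebesgue integral ([translation_invariant_unique]), which gives the behaviour
    of the integral under isometries, dilations and orthogonal projections.
    Similarly, dilation invariance identifies integrals of radial functions in
    dimensions m and n up to a constant ([radial_integral_unique]).  General
    functions are reduced to radial ones by averaging over random rotations,
    obtained by applying the Gram-Schmidt process to a random matrix
    ([rotation_average_enorm]); averaging the invariance of a Haar probability
    over these rotations replaces the Grassmannian by the rotated copies of one
    subspace.  For the bound by the infimum these copies alone are enough
    ([slicing_inf]), so no Haar probability has to be constructed.

    Two points need care.  A subspace is a null set of R^n, so f may exceed M on
    it: the moments are taken of [penalized M f], which is infinite where f > M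
    and has the same integral over R^n.  Integrals over F are defined through
    a chosen orthonormal basis of F; their measurability in F comes from an
    expression that involves only the orthogonal projection onto F
    ([integral_frame_slab]), which is a Borel function of F
    ([measurable_projector]). *)

(** * Measurability of matrix operations *)

Section measurability.
Context {R : realType} d (T : measurableType d).

Lemma measurable_mx_entry m n (f : T -> 'M[R]_(m, n)) i j :
  measurable_fun setT f -> measurable_fun setT (fun t => f t i j : R).
Proof. by move=> mf; exact: measurableT_comp (coord_measurable_mx i j) mf. Qed.

Lemma measurable_mxD m n (f g : T -> 'M[R]_(m, n)) :
  measurable_fun setT f -> measurable_fun setT g ->
  measurable_fun setT (fun t => f t + g t).
Proof.
move=> mf mg; apply: measurable_mx_coord => i j.
under eq_fun do rewrite mxE.
by apply: measurable_funD; exact: measurable_mx_entry.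
Qed.

Lemma measurable_mxB m n (f g : T -> 'M[R]_(m, n)) :
  measurable_fun setT f -> measurable_fun setT g ->
  measurable_fun setT (fun t => f t - g t).
Proof.
move=> mf mg; apply: measurable_mx_coord => i j.
under eq_fun do rewrite !mxE.
by apply: measurable_funB; exact: measurable_mx_entry.
Qed.

Lemma measurable_mxM m n p (f : T -> 'M[R]_(m, n)) (g : T -> 'M[R]_(n, p)) :
  measurable_fun setT f -> measurable_fun setT g ->
  measurable_fun setT (fun t => f t *m g t).
Proof.
move=> mf mg; apply: measurable_mx_coord => i j.
under eq_fun do rewrite mxE.
apply: measurable_sum => l.
by apply: measurable_funM; exact: measurable_mx_entry.
Qed.

Lemma measurable_mx_tr m n (f : T -> 'M[R]_(m, n)) :
  measurable_fun setT f -> measurable_fun setT (fun t => (f t)^T).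
Proof.
move=> mf; apply: measurable_mx_coord => i j.
by under eq_fun do rewrite mxE; exact: measurable_mx_entry.
Qed.

Lemma measurable_mxZ m n (a : T -> R) (f : T -> 'M[R]_(m, n)) :
  measurable_fun setT a -> measurable_fun setT f ->
  measurable_fun setT (fun t => a t *: f t).
Proof.
move=> ma mf; apply: measurable_mx_coord => i j.
under eq_fun do rewrite mxE.
by apply: measurable_funM => //; exact: measurable_mx_entry.
Qed.

Lemma measurable_inv_ge0 (f : T -> R) : (forall t, 0 <= f t) ->
  measurable_fun setT f -> measurable_fun setT (fun t => (f t)^-1).
Proof.
move=> f0 mf.
rewrite (_ : (fun _ => _) = (fun x => x `^ (-1)) \o f); last first.
  by apply/funext => t /=; rewrite powR_inv1.
have mp : measurable_fun setT (fun x : R => x `^ (-1)) by exact: measurable_powR.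
exact: measurableT_comp mp mf.
Qed.

Lemma measurable_indic_le (f g : T -> R) :
  measurable_fun setT f -> measurable_fun setT g ->
  measurable_fun setT (fun t => (f t <= g t)%R%:R%:E : \bar R).
Proof.
move=> mf mg; apply/measurable_EFinP.
rewrite (_ : (fun _ => _) = \1_[set t | f t <= g t]); last first.
  apply/funext => t; rewrite indicE; congr ((nat_of_bool _)%:R).
  by apply/idP/idP; rewrite inE.
apply: measurable_indic; rewrite -[X in measurable X]setTI.
exact: measurable_fun_le.
Qed.

End measurability.

(** * Translations *)

Section translation.
Context {R : realType}.
Local Open Scope ereal_scope.

Lemma integral_lebesgue_measure_shift (a : R) (h : measurableTypeR R -> \bar R) :
  measurable_fun setT h -> (forall x, 0 <= h x) ->
  \int[@lebesgue_measure R]_x h (x + a)%R = \int[@lebesgue_measure R]_x h x.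
Proof.
move=> mh h0.
pose sh : measurableTypeR R -> measurableTypeR R := fun x => (x + a)%R.
have msh : measurable_fun setT sh by exact: measurable_funD.
pose sh_fun : {mfun measurableTypeR R >-> measurableTypeR R} :=
  HB.pack sh (isMeasurableFun.Build _ _ _ _ sh msh).
have shE A : measurable A ->
    image_measure (@lebesgue_measure R) sh_fun A = lebesgue_measure A.
  move=> mA; apply/esym/lebesgue_measure_unique => // _ [[b c]/= _ <-].
  rewrite /image_measure /pushforward /=.
  rewrite (_ : sh @^-1` _ = `](b - a)%R, (c - a)%R]%classic); last first.
    by apply/seteqP; split=> x /=; rewrite !in_itv/= ltrBlDr lerBrDr.
  rewrite !lebesgue_measure_itv/= !lte_fin ltrD2r; case: ifP => // _.
  by rewrite -!EFinB; congr EFin; lra.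
transitivity (\int[image_measure (@lebesgue_measure R) sh_fun]_x h x).
  by rewrite [RHS]ge0_integral_pushforward.
by apply: eq_measure_integral => A mA _; exact: shE.
Qed.

Lemma integral_lebesgue_rVS n (h : 'rV[R]_n.+1 -> \bar R) :
  measurable_fun setT h -> (forall x, 0 <= h x) ->
  \int[lebesgue_rV R n.+1]_x h x =
  \int[@lebesgue_measure R]_x \int[lebesgue_rV R n]_v h (row_cons (x, v)).
Proof.
move=> mh h0.
rewrite [LHS](@ge0_integral_pushforward _ _ _ _ _ (@row_cons R n))//.
rewrite preimage_setT fubini_tonelli1//.
- exact: measurableT_comp mh (measurable_funPT (@row_cons R n)).
- by move=> x; exact: h0.
Qed.

Lemma row_consD n (x a : R) (v w : 'rV[R]_n) :
  row_cons ((x + a)%R, (v + w)%R) = (row_cons (x, v) + row_cons (a, w))%R.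
Proof.
by rewrite /row_cons/= [(x + a)%:M]raddfD; exact: (esym (@add_row_mx R 1 1 n _ _ _ _)).
Qed.

(** Induction on the dimension, one coordinate at a time. *)
Lemma integral_lebesgue_rV_shift n (u : 'rV[R]_n) (h : 'rV[R]_n -> \bar R) :
  measurable_fun setT h -> (forall x, 0 <= h x) ->
  \int[lebesgue_rV R n]_x h (x + u)%R = \int[lebesgue_rV R n]_x h x.
Proof.
elim: n u h => [|n IH] u h mh h0.
  by apply: eq_integral => x _; congr h; apply/rowP => -[].
have [a [w uE]] : exists a w, u = row_cons (a : measurableTypeR R, w).
  exists (lsubmx (u : 'rV_(1 + n)) 0%R 0%R), (rsubmx (u : 'rV_(1 + n))).
  by rewrite /row_cons/= -mx11_scalar hsubmxK.
have msh : measurable_fun setT (fun x : 'rV[R]_n.+1 => (x + u)%R).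
  by apply: measurable_mxD; [exact: measurable_id|exact: measurable_cst].
have mrc := measurable_funPT (@row_cons R n).
rewrite (integral_lebesgue_rVS (measurableT_comp mh msh) (fun=> h0 _)) /=.
rewrite (integral_lebesgue_rVS mh h0) uE.
under eq_integral => x _.
  under eq_integral => v _ do rewrite -row_consD.
  over.
pose G (x : measurableTypeR R) := \int[lebesgue_rV R n]_v h (row_cons (x, v)).
transitivity (\int[@lebesgue_measure R]_x G (x + a)%R); last first.
  apply: integral_lebesgue_measure_shift; last by move=> x; exact: integral_ge0.
  apply: (measurable_fun_fubini_tonelli_F (h \o @row_cons R n)).
    exact: measurableT_comp mh mrc.
  by move=> x; exact: h0.
apply: eq_integral => x _.
rewrite -[RHS](IH w)//.
exact: measurableT_comp mh (measurableT_comp mrc (measurable_pair1 _)).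
Qed.

End translation.

(** * Uniqueness of translation invariant integrals *)

Section uniqueness.
Context {R : realType}.
Local Open Scope ereal_scope.

(** Both sides equal the double integral of [w x * h (phi x + y) * b y]: for
    fixed [y] translate [x], for fixed [x] translate [y], and use that [b] is
    even.  With [b] the indicator function of a ball this says that the
    functional sending [h] to the integral of [w x * h (phi x)] is a multiple of
    the Lebesgue integral, because it is invariant under translations. *)
Lemma translation_invariant_unique N m (phi : 'rV[R]_N -> 'rV[R]_m)
    (w : 'rV[R]_N -> \bar R) (b h : 'rV[R]_m -> \bar R) :
  measurable_fun setT phi -> {morph phi : x y / (x + y)%R} ->
  measurable_fun setT w -> (forall x, 0 <= w x) ->
  measurable_fun setT b -> (forall x, 0 <= b x) ->
  measurable_fun setT h -> (forall x, 0 <= h x) ->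
  (forall v, exists2 u, phi u = v & forall x, w (x + u)%R = w x) ->
  (forall y, b (- y)%R = b y) ->
  (\int[lebesgue_rV R m]_y b y) * (\int[lebesgue_rV R N]_x (w x * h (phi x))) =
  (\int[lebesgue_rV R m]_y h y) * (\int[lebesgue_rV R N]_x (w x * b (phi x))).
Proof.
move=> mphi phiD mw w0 mb b0 mh h0 onto beven.
have mwh : measurable_fun setT (fun x => w x * h (phi x)).
  by apply: emeasurable_funM => //; exact: measurableT_comp.
have mwb : measurable_fun setT (fun x => w x * b (phi x)).
  by apply: emeasurable_funM => //; exact: measurableT_comp.
have mphi1 : measurable_fun setT (fun z : 'rV[R]_N * 'rV[R]_m => phi z.1).
  exact: measurableT_comp mphi measurable_fst.
have addm : measurable_fun setT (fun z : 'rV[R]_N * 'rV[R]_m => (phi z.1 + z.2)%R).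
  by apply: measurable_mxD => //; exact: measurable_snd.
have subm : measurable_fun setT (fun z : 'rV[R]_N * 'rV[R]_m => (z.2 - phi z.1)%R).
  by apply: measurable_mxB => //; exact: measurable_snd.
pose D z := w z.1 * (h (phi z.1 + z.2)%R * b z.2).
have mD : measurable_fun setT D.
  apply: emeasurable_funM; first exact: measurableT_comp mw measurable_fst.
  apply: emeasurable_funM; first exact: measurableT_comp mh addm.
  exact: measurableT_comp mb measurable_snd.
pose E z := w z.1 * (h z.2 * b (z.2 - phi z.1)%R).
have mE : measurable_fun setT E.
  apply: emeasurable_funM; first exact: measurableT_comp mw measurable_fst.
  apply: emeasurable_funM; first exact: measurableT_comp mh measurable_snd.
  exact: measurableT_comp mb subm.
have D0 z : 0 <= D z by rewrite /D !mule_ge0.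
have E0 z : 0 <= E z by rewrite /E !mule_ge0.
transitivity (\int[lebesgue_rV R N]_x \int[lebesgue_rV R m]_y D (x, y)).
  rewrite (fubini_tonelli D mD D0) -ge0_integralZr//;
    last by apply: integral_ge0 => x _; exact: mule_ge0.
  apply: eq_integral => y _.
  have [u uy wu] := onto y.
  transitivity (\int[lebesgue_rV R N]_x (w (x + u)%R * h (phi (x + u)%R) * b y));
    last by apply: eq_integral => x _; rewrite /D/= wu phiD uy muleA.
  transitivity (\int[lebesgue_rV R N]_x (w x * h (phi x) * b y)).
    rewrite ge0_integralZr//; first by rewrite muleC.
    by move=> x _; rewrite mule_ge0.
  rewrite [RHS](@integral_lebesgue_rV_shift R N u (fun x => w x * h (phi x) * b y))//.
    by apply: emeasurable_funM.
  by move=> x; rewrite !mule_ge0.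
transitivity (\int[lebesgue_rV R N]_x \int[lebesgue_rV R m]_y E (x, y)).
  apply: eq_integral => x _.
  rewrite -(@integral_lebesgue_rV_shift R m (phi x) (fun y => E (x, y)))//.
    by apply: eq_integral => y _; rewrite /E /D/= addrK [(phi x + y)%R]addrC.
  exact: measurableT_comp mE (measurable_pair1 x).
rewrite (fubini_tonelli E mE E0) -ge0_integralZr//;
  last by apply: integral_ge0 => x _; exact: mule_ge0.
apply: eq_integral => y _.
have [u uy wu] := onto y.
transitivity (\int[lebesgue_rV R N]_x (h y * (w x * b (phi x)))).
  rewrite -[LHS](integral_lebesgue_rV_shift u)//; last first.
    exact: measurableT_comp mE (measurable_pair2 y).
  apply: eq_integral => x _; rewrite /E/= wu muleCA phiD uy.
  by rewrite opprD addrCA subrr addr0 beven.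
by rewrite ge0_integralZl// => x _; rewrite mule_ge0.
Qed.

End uniqueness.

(** * Euclidean norm, balls and scaling *)

Section euclidean_norm.
Context {R : realType}.

Definition enorm n (x : 'rV[R]_n) : R := Num.sqrt (\sum_i x 0 i ^+ 2).

Lemma sum_sqr_ge0 n (x : 'rV[R]_n) : 0 <= \sum_i x 0 i ^+ 2.
Proof. by rewrite sumr_ge0// => i _; exact: sqr_ge0. Qed.

Lemma enorm_ge0 n (x : 'rV[R]_n) : 0 <= enorm x.
Proof. exact: sqrtr_ge0. Qed.

Lemma sqr_enorm n (x : 'rV[R]_n) : enorm x ^+ 2 = \sum_i x 0 i ^+ 2.
Proof. by rewrite sqr_sqrtr ?sum_sqr_ge0. Qed.

Lemma mul_tr_enorm n (x : 'rV[R]_n) : x *m x^T = (enorm x ^+ 2)%:M.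
Proof.
apply/matrixP => i j; rewrite !ord1 sqr_enorm !mxE mulr1n.
by apply: eq_bigr => l _; rewrite mxE expr2.
Qed.

Lemma enorm_eq_mul_tr m n (x : 'rV[R]_m) (y : 'rV[R]_n) :
  x *m x^T = y *m y^T -> enorm x = enorm y.
Proof.
rewrite !mul_tr_enorm => /matrixP/(_ 0 0); rewrite !mxE !mulr1n => xy.
by apply/eqP; rewrite -(@eqrXn2 _ 2) ?enorm_ge0//; apply/eqP.
Qed.

Lemma enorm_mul_isometry m n (y : 'rV[R]_m) (U : 'M[R]_(m, n)) :
  U *m U^T = 1%:M -> enorm (y *m U) = enorm y.
Proof.
move=> UU; apply: enorm_eq_mul_tr.
by rewrite trmx_mul mulmxA -(mulmxA y) UU mulmx1.
Qed.

Lemma enorm0 n : enorm (0 : 'rV[R]_n) = 0.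
Proof.
by rewrite /enorm big1 ?sqrtr0// => i _; rewrite mxE expr0n.
Qed.

Lemma enorm_eq0 n (x : 'rV[R]_n) : (enorm x == 0) = (x == 0).
Proof.
apply/eqP/eqP => [x0|->]; last exact: enorm0.
by apply: mul_tr_row_eq0; rewrite mul_tr_enorm x0 expr0n/= raddf0.
Qed.

Lemma enormZ n (a : R) (x : 'rV[R]_n) : enorm (a *: x) = `|a| * enorm x.
Proof.
rewrite /enorm -sqrtr_sqr -sqrtrM ?sqr_ge0// mulr_sumr.
by congr Num.sqrt; apply: eq_bigr => i _; rewrite mxE exprMn.
Qed.

Lemma enormN n (x : 'rV[R]_n) : enorm (- x) = enorm x.
Proof. by rewrite -scaleN1r enormZ normrN1 mul1r. Qed.

Lemma ler_coord_enorm n (x : 'rV[R]_n) i : `|x 0 i| <= enorm x.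
Proof.
rewrite -(@ler_pXn2r _ 2) ?nnegrE ?enorm_ge0// sqr_enorm real_normK ?num_real//.
by rewrite (bigD1 i)//= lerDl sumr_ge0// => j _; exact: sqr_ge0.
Qed.

Lemma enorm_le_coord n (x : 'rV[R]_n) (c : R) :
  (forall i, `|x 0 i| <= c) -> enorm x <= n%:R * c.
Proof.
case: n x => [|n] x xc; first by rewrite /enorm big_ord0 sqrtr0 mul0r.
have c0 : 0 <= c by exact: le_trans (normr_ge0 _) (xc 0).
rewrite -(@ler_pXn2r _ 2) ?nnegrE ?enorm_ge0 ?mulr_ge0// sqr_enorm.
apply: (@le_trans _ _ (\sum_(i < n.+1) c ^+ 2)).
  apply: ler_sum => i _; rewrite -[x 0 i ^+ 2]real_normK ?num_real//.
  by rewrite ler_pXn2r ?nnegrE.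
rewrite sumr_const card_ord exprMn -[leLHS]mulr_natl ler_wpM2r ?sqr_ge0//.
by rewrite -natrX ler_nat expnS leq_pmulr.
Qed.

Lemma measurable_enorm d (T : measurableType d) n (f : T -> 'rV[R]_n) :
  measurable_fun setT f -> measurable_fun setT (fun t => enorm (f t)).
Proof.
move=> mf; have msqrt : measurable_fun setT (@Num.sqrt R).
  by apply: continuous_measurable_fun; exact: sqrt_continuous.
apply: (measurableT_comp msqrt).
apply: measurable_sum => i.
by apply: measurable_funX; exact: measurable_mx_entry.
Qed.

End euclidean_norm.

Section balls.
Context {R : realType}.
Local Open Scope ereal_scope.

Lemma muleI_gt0 (r : R) (x y : \bar R) : (0 < r)%R ->
  x * r%:E = y * r%:E -> x = y.
Proof.
move=> r0 /(congr1 (fun z => z * r^-1%:E)).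
by rewrite -!muleA -!EFinM divff ?gt_eqF// !mule1.
Qed.

Definition cube n (r : R) : set 'rV[R]_n := [set x | forall i, (`|x 0%R i| <= r)%R].
Arguments cube : clear implicits.

Lemma cubeE n (r : R) : cube n r = [set x | forall i, `[(- r)%R, r]%classic (x 0%R i)].
Proof.
by apply/seteqP; split=> x xr i; have := xr i; rewrite /= in_itv/= ler_norml.
Qed.

Lemma lebesgue_cube n (r : R) : (0 <= r)%R ->
  lebesgue_rV R n (cube n r) = ((r + r) ^+ n)%R%:E.
Proof.
move=> r0; rewrite cubeE.
rewrite (@lebesgue_rV_box R n (fun=> `[(- r)%R, r]%classic)); last first.
  by move=> i; exact: measurable_itv.
under eq_bigr do rewrite lebesgue_measure_itv/= lte_fin.
rewrite -[in RHS](card_ord n) -prodr_const -prodEFin; apply: eq_bigr => i _.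
have [_|rr] := ltP; first by rewrite -EFinB opprK.
by congr EFin; lra.
Qed.

Lemma measurable_cube n (r : R) : measurable (cube n r).
Proof.
rewrite (_ : cube n r = \bigcap_(i in [set: 'I_n])
    (setT `&` (fun x : 'rV[R]_n => x 0%R i : measurableTypeR R) @^-1`
      `[(- r)%R, r]%classic)).
  apply: fin_bigcap_measurable => // i _.
  by apply: coord_measurable_mx => //; exact: measurable_itv.
rewrite cubeE; apply/seteqP; split=> x /= xr; first by move=> i _; split => //; exact: xr.
by move=> i; have [] := xr i I.
Qed.

Lemma measurable_eball n (r : R) : measurable [set x : 'rV[R]_n | (enorm x <= r)%R].
Proof.
rewrite -[X in measurable X]setTI; apply: measurable_fun_le => //.
exact: measurable_enorm (@measurable_id _ _ _).
Qed.

Lemma eball1E n : [set x : 'rV[R]_n | (\sum_i x 0 i ^+ 2 <= 1)%R] =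
  [set x | (enorm x <= 1)%R].
Proof.
apply/seteqP; split=> x /=; rewrite -sqr_enorm expr_le1// ?enorm_ge0//.
Qed.

Lemma cube_sub_eball n : cube n (n.+1%:R^-1) `<=` [set x | (enorm x <= 1)%R].
Proof.
move=> x /enorm_le_coord /=; apply: (fun a b => le_trans b a).
by rewrite ler_pdivrMr// mul1r ler_nat.
Qed.

Lemma eball_sub_cube n (r : R) : [set x | (enorm x <= r)%R] `<=` cube n r.
Proof. by move=> x /= xr i; apply: le_trans xr; exact: ler_coord_enorm. Qed.

Lemma lebesgue_eball_lty n (r : R) :
  lebesgue_rV R n [set x | (enorm x <= r)%R] < +oo.
Proof.
have r0 : (0 <= Num.max r 0)%R by rewrite le_max lexx orbT.
apply: (@le_lt_trans _ _ (lebesgue_rV R n (cube n (Num.max r 0)%R))).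
  apply: le_measure; rewrite ?inE; [exact: measurable_eball|exact: measurable_cube|].
  apply: subset_trans (@eball_sub_cube _ _) => x /= xr.
  by rewrite le_max xr.
by rewrite lebesgue_cube// ltry.
Qed.

Lemma lebesgue_eball1 n :
  lebesgue_rV R n [set x | (enorm x <= 1)%R] = (omega R n)%:E.
Proof.
have := lebesgue_eball_lty n 1; rewrite -eball1E => fin.
by rewrite /omega fineK// ge0_fin_numE.
Qed.

Lemma omega_gt0 n : (0 < omega R n)%R.
Proof.
rewrite -lte_fin -lebesgue_eball1.
have c0 : (0 < n.+1%:R^-1 :> R)%R by rewrite invr_gt0.
apply: (@lt_le_trans _ _ (lebesgue_rV R n (cube n n.+1%:R^-1))).
  by rewrite lebesgue_cube ?ltW// lte_fin exprn_gt0// addr_gt0.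
apply: le_measure; rewrite ?inE; [exact: measurable_cube|exact: measurable_eball|].
exact: cube_sub_eball.
Qed.

Definition eball_indic n (r : R) (x : 'rV[R]_n) : \bar R := (enorm x <= r)%R%:R%:E.

Lemma eball_indic_ge0 n r (x : 'rV[R]_n) : 0 <= eball_indic r x.
Proof. by rewrite lee_fin. Qed.

Lemma measurable_eball_indic n r : measurable_fun setT (@eball_indic n r).
Proof.
apply: measurable_indic_le => //.
exact: measurable_enorm (@measurable_id _ _ _).
Qed.

Lemma integral_eball_indic n r :
  \int[lebesgue_rV R n]_x eball_indic r x = lebesgue_rV R n [set x | (enorm x <= r)%R].
Proof.
rewrite -[X in lebesgue_rV R n X]setIT -integral_indic//; last exact: measurable_eball.
apply: eq_integral => x _; rewrite indicE; congr ((nat_of_bool _)%:R%:E).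
by apply/idP/idP; rewrite inE.
Qed.

(** An additive bijection preserving the Euclidean norm preserves the unit ball,
    hence the constant of [translation_invariant_unique] is [1]. *)
Lemma integral_lebesgue_rV_isometry n (phi : 'rV[R]_n -> 'rV[R]_n)
    (h : 'rV[R]_n -> \bar R) :
  measurable_fun setT phi -> {morph phi : x y / (x + y)%R} ->
  (forall y, exists x, phi x = y) -> (forall x, enorm (phi x) = enorm x) ->
  measurable_fun setT h -> (forall x, 0 <= h x) ->
  \int[lebesgue_rV R n]_x h (phi x) = \int[lebesgue_rV R n]_x h x.
Proof.
move=> mphi phiD onto phin mh h0.
have := @translation_invariant_unique R n n phi (cst 1) (@eball_indic n 1) h mphi phiD
  (measurable_cst _) (fun _ => lee01) (@measurable_eball_indic n 1)
  (@eball_indic_ge0 n 1) mh h0.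
have -> : (fun x => cst 1 x * h (phi x)) = h \o phi.
  by apply/funext => x; rewrite mul1e.
have -> : (fun x => cst 1 x * eball_indic 1 (phi x)) = @eball_indic n 1.
  by apply/funext => x; rewrite mul1e /eball_indic phin.
rewrite integral_eball_indic lebesgue_eball1 muleC => H.
apply: (muleI_gt0 (omega_gt0 n)); apply: H => [v|y].
  by have [u <-] := onto v; exists u.
by rewrite /eball_indic enormN.
Qed.

(** The even test set of [translation_invariant_unique] is here a cube, the volume
    of whose dilations is a product of lengths. *)
Lemma integral_lebesgue_rVZ n (r : R) (h : 'rV[R]_n -> \bar R) : (0 < r)%R ->
  measurable_fun setT h -> (forall x, 0 <= h x) ->
  \int[lebesgue_rV R n]_x h (r *: x)%R =
  (r^-1 ^+ n)%R%:E * \int[lebesgue_rV R n]_x h x.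
Proof.
move=> r0 mh h0.
pose b s (x : 'rV[R]_n) : \bar R := (\1_(cube n s) x)%:E.
have mb s : measurable_fun setT (b s).
  by apply/measurable_EFinP; apply: measurable_indic; exact: measurable_cube.
have b0 s x : 0 <= b s x by rewrite lee_fin.
have ib s : (0 <= s)%R -> \int[lebesgue_rV R n]_x b s x = ((s + s) ^+ n)%R%:E.
  move=> s0; rewrite integral_indic ?setIT //; last exact: measurable_cube.
  exact: lebesgue_cube.
have mZ : measurable_fun setT (fun x : 'rV[R]_n => (r *: x)%R).
  by apply: measurable_mxZ => //; exact: measurable_id.
have := @translation_invariant_unique R n n ( *:%R r) (cst 1) (b 1%R) h mZ
  (scalerDr r) (measurable_cst _) (fun _ => lee01) (mb _) (b0 _) mh h0.
have -> : (fun x => cst 1 x * h (r *: x)%R) = fun x => h (r *: x)%R.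
  by apply/funext => x; rewrite mul1e.
have -> : (fun x => cst 1 x * b 1%R (r *: x)%R) = b r^-1%R.
  apply/funext => x; rewrite mul1e /b !indicE; congr ((nat_of_bool _)%:R%:E).
  apply/idP/idP; rewrite !inE => xr i; have := xr i;
    rewrite mxE normrM gtr0_norm// mulrC -ler_pdivlMr// mul1r//.
rewrite !ib ?invr_ge0 ?ltW// => H.
have {}H := H (fun v => ex_intro2 _ _ (r^-1 *: v)%R
  (scalerKV (lt0r_neq0 r0) v) (fun=> erefl)).
apply: (@muleI_gt0 ((1 + 1) ^+ n)%R); first by rewrite exprn_gt0// addr_gt0.
rewrite muleC H.
  rewrite muleC [in RHS]muleAC -EFinM -exprMn mulrDr mulr1//.
move=> y; rewrite /b !indicE; congr ((nat_of_bool _)%:R%:E).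
by apply/idP/idP; rewrite !inE => xr i; have := xr i; rewrite mxE normrN.
Qed.

Lemma lebesgue_eball n (r : R) : (0 < r)%R ->
  lebesgue_rV R n [set x | (enorm x <= r)%R] = (r ^+ n * omega R n)%R%:E.
Proof.
move=> r0; rewrite -integral_eball_indic.
have rn0 : (0 < r^-1 ^+ n)%R by rewrite exprn_gt0// invr_gt0.
apply: (muleI_gt0 rn0).
rewrite muleC -integral_lebesgue_rVZ//; last 2 first.
- exact: measurable_eball_indic.
- exact: eball_indic_ge0.
rewrite -EFinM mulrAC -exprMn divff ?gt_eqF// expr1n mul1r.
rewrite -lebesgue_eball1 -integral_eball_indic.
apply: eq_integral => x _; rewrite /eball_indic enormZ gtr0_norm//.
by rewrite mulrC -ler_pdivlMr// divff// gt_eqF.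
Qed.

Lemma lebesgue_rV_set1 n (x : 'rV[R]_n) : (0 < n)%N -> lebesgue_rV R n [set x] = 0.
Proof.
case: n x => // n x _.
rewrite (_ : [set x] = [set y : 'rV[R]_n.+1 | forall i, [set x 0%R i] (y 0%R i)]).
  rewrite (@lebesgue_rV_box R n.+1 (fun i => [set x 0%R i]))//.
  by rewrite big_ord_recl lebesgue_measure_set1 mul0e.
by apply/seteqP; split=> [y ->//|y yx]; apply/rowP => i; exact: yx.
Qed.

End balls.
Arguments cube {R} n r : rename.

(** * Random rotations *)

Section gram_schmidt.
Context {R : realType}.

Fixpoint gram_schmidt {n} m : 'M[R]_(m, n) -> 'M[R]_(m, n) :=
  if m is m'.+1 then fun A : 'M[R]_(1 + m', n) =>
    let E := gram_schmidt (dsubmx A) in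
    let v := usubmx A - usubmx A *m E^T *m E in
    col_mx ((enorm v)^-1 *: v) E
  else fun=> 0.

(** The process uses only inner products, so it commutes with isometries: this is
    what makes the law of the random rotations below invariant. *)
Lemma gram_schmidt_mulmx m n (A : 'M[R]_(m, n)) (S : 'M[R]_n) :
  S *m S^T = 1%:M -> gram_schmidt (A *m S) = gram_schmidt A *m S.
Proof.
move=> SS; elim: m A => [|m IH] A; first by rewrite /= mul0mx.
rewrite [LHS]/= [X in _ = X *m S]/=.
rewrite -[A in LHS](@vsubmxK _ 1 m) (@mul_col_mx _ 1 m) col_mxKu col_mxKd IH.
set E := gram_schmidt _; set u := usubmx _.
rewrite [RHS](@mul_col_mx _ 1 m) trmx_mul.
have -> : u *m S *m (S^T *m E^T) *m (E *m S) = u *m E^T *m E *m S.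
  by rewrite !mulmxA -(mulmxA u S) SS mulmx1.
by rewrite -mulmxBl enorm_mul_isometry// scalemxAl.
Qed.

Lemma measurable_gram_schmidt d (T : measurableType d) m n (f : T -> 'M[R]_(m, n)) :
  measurable_fun setT f -> measurable_fun setT (fun t => gram_schmidt (f t)).
Proof.
elim: m f => [|m IH] f mf.
  by rewrite [X in measurable_fun _ X](_ : _ = cst 0)//; exact: measurable_cst.
have mu : measurable_fun setT (fun t => @usubmx _ 1 m n (f t)).
  apply: measurable_mx_coord => i j; under eq_fun do rewrite mxE.
  exact: measurable_mx_entry.
have /IH mE : measurable_fun setT (fun t => @dsubmx _ 1 m n (f t)).
  apply: measurable_mx_coord => i j; under eq_fun do rewrite mxE.
  exact: measurable_mx_entry.
pose v t := @usubmx _ 1 m n (f t) - @usubmx _ 1 m n (f t) *m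
  (gram_schmidt (@dsubmx _ 1 m n (f t)))^T *m gram_schmidt (@dsubmx _ 1 m n (f t)).
have mv : measurable_fun setT v.
  apply: measurable_mxB => //; apply: measurable_mxM => //.
  by apply: measurable_mxM => //; exact: measurable_mx_tr.
have mw : measurable_fun setT (fun t => (enorm (v t))^-1 *: v t).
  apply: measurable_mxZ => //; apply: measurable_inv_ge0 => [t|].
    exact: enorm_ge0.
  exact: measurable_enorm.
apply: measurable_mx_coord => i j.
case: (@splitP 1 m i) => i' ii'.
  have -> : i = lshift m i' by exact: val_inj.
  under eq_fun do rewrite (@col_mxEu _ 1 m).
  exact: measurable_mx_entry.
have -> : i = rshift 1 i' by exact: val_inj.
under eq_fun do rewrite (@col_mxEd _ 1 m).
exact: measurable_mx_entry.
Qed.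

Lemma gram_schmidt_sub m n (A : 'M[R]_(m, n)) : (gram_schmidt A <= A)%MS.
Proof.
elim: m A => [|m IH] A; first by rewrite sub0mx.
have uA : (@usubmx _ 1 m n A <= A)%MS.
  apply: (submx_trans (addsmxSl _ (@dsubmx _ 1 m n A))).
  by rewrite addsmxE vsubmxK.
have dA : (@dsubmx _ 1 m n A <= A)%MS.
  apply: (submx_trans (addsmxSr (@usubmx _ 1 m n A) _)).
  by rewrite addsmxE vsubmxK.
have EA := submx_trans (IH (@dsubmx _ 1 m n A)) dA.
rewrite (@col_mx_sub _ 1 m) EA andbT scalemx_sub//.
by rewrite addmx_sub// eqmx_opp (submx_trans _ EA)// submxMl.
Qed.

Lemma gram_schmidt_orthonormal m n (A : 'M[R]_(m, n)) :
  row_free A -> gram_schmidt A *m (gram_schmidt A)^T = 1%:M.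
Proof.
elim: m A => [|m IH] A; first by move=> _; apply/matrixP => -[].
set d := @dsubmx _ 1 m n A; set u := @usubmx _ 1 m n A => freeA.
have rkA : \rank (u + d)%MS = m.+1.
  by rewrite addsmxE vsubmxK; exact/eqP.
have freed : row_free d.
  rewrite /row_free eqn_leq rank_leq_row/= -ltnS -{1}rkA.
  by rewrite (leq_trans (mxrank_adds_leqif _ _))// -[leqRHS]add1n leq_add2r rank_leq_row.
have EE := IH _ freed; set E := gram_schmidt d in EE.
pose v := u - u *m E^T *m E.
have vE : v *m E^T = 0 by rewrite mulmxBl -!mulmxA EE mulmx1 subrr.
have v0 : enorm v != 0.
  rewrite enorm_eq0 subr_eq0; apply/eqP => uE.
  have ud : (u <= d)%MS.
    by rewrite uE (submx_trans (submxMl _ _))// gram_schmidt_sub.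
  by have := rank_leq_row d; rewrite -(addsmx_idPr ud) rkA ltnn.
have vv : ((enorm v)^-1 *: v) *m ((enorm v)^-1 *: v)^T = 1%:M.
  rewrite mul_tr_enorm enormZ ger0_norm ?invr_ge0 ?enorm_ge0//.
  by rewrite mulVf// expr1n.
have -> : gram_schmidt A = col_mx ((enorm v)^-1 *: v) E by [].
have wE : ((enorm v)^-1 *: v) *m E^T = 0 by rewrite -scalemxAl vE scaler0.
have Ew : E *m ((enorm v)^-1 *: v)^T = 0.
  by rewrite -[LHS]trmxK trmx_mul trmxK wE trmx0.
rewrite (@tr_col_mx _ 1 m) (@mul_col_row _ 1 m n 1 m) vv wE Ew EE.
by rewrite -scalar_mx_block.
Qed.

Lemma row_free_full_rank m n (A : 'M[R]_(m, n)) :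
  \dim (rowspan A) = m -> row_free A.
Proof.
move=> /eqP; rewrite dim_rowspan => detA.
apply/row_freeP; exists (A^T *m invmx (A *m A^T)).
by rewrite mulmxA mulmxV// unitmxE unitfE.
Qed.

End gram_schmidt.

Section rotations.
Context {R : realType} (n : nat).
Local Notation N := (n * n)%N.

(** Transposed, so that the invariance of the law under right multiplication of
    the random matrix becomes an invariance under multiplication of the rotation
    from the left, the side on which it meets row vectors. *)
Definition rotation (v : 'rV[R]_N) : 'M[R]_n := (gram_schmidt (vec_mx v))^T.

(** The indicator function of the matrices in the unit ball on which the
    Gram-Schmidt process succeeds; orthogonality is written as the vanishing of a
    norm to make the measurability evident. *)
Definition rotation_weight (v : 'rV[R]_N) : \bar R :=
  ((enorm v <= 1)%R%:R%:E *
   (enorm (mxvec ((rotation v)^T *m rotation v - 1%:M)) <= 0)%R%:R%:E)%E.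

Lemma rotation_weightE v : rotation_weight v =
  ((enorm v <= 1) && (rotation v *m (rotation v)^T == 1%:M))%:R%:E.
Proof.
rewrite /rotation_weight -EFinM -natrM mulnb; congr ((nat_of_bool (_ && _))%:R%:E).
rewrite -[LHS]andbT -(enorm_ge0 (mxvec ((rotation v)^T *m rotation v - 1%:M))).
rewrite -eq_le enorm_eq0.
have -> : (mxvec ((rotation v)^T *m rotation v - 1%:M) == 0) =
    ((rotation v)^T *m rotation v == 1%:M).
  by rewrite -[RHS]subr_eq0 -[RHS](inj_eq (can_inj mxvecK)) [mxvec 0]linear0.
by apply/eqP/eqP => /mulmx1C.
Qed.

Lemma rotation_weight_ge0 v : (0 <= rotation_weight v)%E.
Proof. by rewrite rotation_weightE lee_fin. Qed.

Lemma measurable_rotation : measurable_fun setT rotation.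
Proof.
apply: measurable_mx_tr; apply: measurable_gram_schmidt.
apply: measurable_mx_coord => i j; under eq_fun do rewrite mxE.
exact: measurable_mx_entry (@measurable_id _ _ _).
Qed.

Lemma measurable_rotation_weight : measurable_fun setT rotation_weight.
Proof.
have mr := measurable_rotation.
apply: emeasurable_funM; apply: measurable_indic_le => //.
  exact: measurable_enorm (@measurable_id _ _ _).
apply: measurable_enorm.
have mM : measurable_fun setT (fun v => (rotation v)^T *m rotation v - 1%:M).
  apply: measurable_mxB; last exact: measurable_cst.
  by apply: measurable_mxM => //; exact: measurable_mx_tr.
apply: measurable_mx_coord => i j; rewrite ord1.
case/mxvec_indexP: j => a b; under eq_fun do rewrite mxvecE.
exact: measurable_mx_entry.
Qed.

Definition rotation_mass : \bar R := (\int[lebesgue_rV R N]_v rotation_weight v)%E.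

Lemma rotation_mass_lty : (rotation_mass < +oo)%E.
Proof.
apply: le_lt_trans (@lebesgue_eball_lty R N 1); rewrite -integral_eball_indic.
apply: ge0_le_integral => //.
- by move=> v _; exact: rotation_weight_ge0.
- exact: measurable_rotation_weight.
- exact: measurable_eball_indic.
- move=> v _; rewrite rotation_weightE /eball_indic lee_fin ler_nat.
  by case: (enorm v <= 1); case: (_ == _).
Qed.

(** Near a small multiple of the identity all the matrices are invertible, and
    the Gram-Schmidt process succeeds on them. *)
Lemma rotation_mass_gt0 : (0 < rotation_mass)%E.
Proof.
pose c : R := (2 * N.+1%:R)^-1.
have c0 : 0 < c by rewrite invr_gt0 mulr_gt0.
pose C : 'M[R]_n := c%:M.
have C1 : \dim (rowspan C) = n.
  apply/eqP; rewrite dim_rowspan tr_scalar_mx -scalar_mxM det_scalar.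
  by rewrite expf_neq0// mulf_neq0// gt_eqF.
have /nbhs_ballP[e /= e0 eC] := open_nbhs_nbhs (conj (@full_rank_open R n n) C1).
pose r := Num.min e c.
have r0 : 0 < r by rewrite lt_min e0 c0.
pose A i : set (measurableTypeR R) := `]mxvec C 0 i - r, mxvec C 0 i + r[%classic.
have mA i : measurable (A i) by exact: measurable_itv.
have Cc i : `|mxvec C 0 i| <= c.
  case/mxvec_indexP: i => a b; rewrite mxvecE mxE.
  by case: (a == b); rewrite ?mulr1n ?mulr0n ?normr0 ?gtr0_norm// ltW.
pose B := [set v : 'rV[R]_N | forall i, A i (v 0 i)].
have mB : measurable B.
  rewrite (_ : B = \bigcap_(i in [set: 'I_N])
      (setT `&` (fun x : 'rV[R]_N => x 0 i : measurableTypeR R) @^-1` A i)).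
    by apply: fin_bigcap_measurable => // i _; exact: coord_measurable_mx.
  apply/seteqP; split=> x /= xr; first by move=> i _; split => //; exact: xr.
  by move=> i; have [] := xr i I.
have Br v i : B v -> `|mxvec C 0 i - v 0 i| < r.
  by move=> /(_ i); rewrite /A/= in_itv/= ltr_distlC.
have B1 v : B v -> rotation_weight v = 1%E.
  move=> Bv; rewrite rotation_weightE.
  have -> : enorm v <= 1.
    have : forall i, `|v 0 i| <= N.+1%:R^-1.
      move=> i; rewrite -[v 0 i](subrK (mxvec C 0 i)).
      rewrite (le_trans (ler_normD _ _))//.
      apply: (@le_trans _ _ (c + c)).
        rewrite lerD// distrC ltW// (lt_le_trans (Br _ i Bv))//.
        by rewrite ge_min lexx orbT.
      rewrite /c invfM -mulrDl (_ : 2^-1 + 2^-1 = 1) ?mul1r//.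
      by field.
    move=> /enorm_le_coord /le_trans; apply.
    by rewrite ler_pdivrMr// mul1r ler_nat.
  rewrite /=; have -> : rotation v *m (rotation v)^T == 1%:M.
    apply/eqP/mulmx1C; rewrite trmxK; apply: gram_schmidt_orthonormal.
    apply: row_free_full_rank; apply: eC => /=; split => // i j.
    rewrite /ball/= [X in _ - X]mxE (lt_le_trans _ (_ : r <= e))//.
      by have := Br v (mxvec_index i j) Bv; rewrite mxvecE.
    by rewrite ge_min lexx.
  by [].
apply: (@lt_le_trans _ _ (lebesgue_rV R N B)).
  rewrite lebesgue_rV_box//.
  under eq_bigr do rewrite lebesgue_measure_itv/= lte_fin ltrD2l gt0_cp// -EFinB.
  by rewrite prodEFin lte_fin; apply: prodr_gt0 => i _; lra.
rewrite /rotation_mass -[X in lebesgue_rV R N X]setIT -integral_indic//.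
apply: ge0_le_integral => //.
- by apply/measurable_EFinP; exact: measurable_indic.
- exact: measurable_rotation_weight.
- move=> v _; rewrite indicE; case: (boolP (v \in B)) => [|_].
    by rewrite inE => /B1 ->.
  exact: rotation_weight_ge0.
Qed.

End rotations.

Section rotation_average.
Context {R : realType} (n : nat).
Local Notation N := (n * n)%N.
Local Open Scope ereal_scope.

Lemma enorm_mxvec_isometry m (A : 'M[R]_(m, n)) (S : 'M[R]_n) :
  (S *m S^T = 1%:M)%R -> enorm (mxvec (A *m S)) = enorm (mxvec A).
Proof.
move=> SS.
have sqE (B : 'M[R]_(m, n)) :
    (\sum_k mxvec B 0 k ^+ 2 = \sum_i enorm (row i B) ^+ 2)%R.
  rewrite (reindex _ (curry_mxvec_bij m n))/=.
  transitivity (\sum_(ij : 'I_m * 'I_n) B ij.1 ij.2 ^+ 2)%R.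
    by apply: eq_bigr => -[i j] _; rewrite /uncurry mxvecE.
  rewrite -(pair_bigA _ (fun i j => B i j ^+ 2)%R)/=; apply: eq_bigr => i _.
  by rewrite sqr_enorm; apply: eq_bigr => j _; rewrite mxE.
rewrite /enorm !sqE; congr Num.sqrt; apply: eq_bigr => i _.
by rewrite row_mul enorm_mul_isometry.
Qed.

(** Not normalized: the average of the constant function 1 is [rotation_mass n]. *)
Definition rotation_average (h : 'rV[R]_n -> \bar R) (x : 'rV[R]_n) : \bar R :=
  \int[lebesgue_rV R N]_v (rotation_weight v * h (x *m rotation v)%R).

Variable h : 'rV[R]_n -> \bar R.
Hypotheses (mh : measurable_fun setT h) (h0 : forall x, 0 <= h x).

Lemma rotation_average_ge0 x : 0 <= rotation_average h x.
Proof.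
by apply: integral_ge0 => v _; rewrite mule_ge0// rotation_weight_ge0.
Qed.

Lemma measurable_rotation_average_kernel : measurable_fun setT
  (fun z : 'rV[R]_n * 'rV[R]_N => rotation_weight z.2 * h (z.1 *m rotation z.2)%R).
Proof.
apply: emeasurable_funM.
  exact: measurableT_comp (@measurable_rotation_weight R n) measurable_snd.
apply: (measurableT_comp mh); apply: measurable_mxM; first exact: measurable_fst.
exact: measurableT_comp (@measurable_rotation R n) measurable_snd.
Qed.

Lemma measurable_rotation_average : measurable_fun setT (rotation_average h).
Proof.
apply: (measurable_fun_fubini_tonelli_F
  (fun z : 'rV[R]_n * 'rV[R]_N => rotation_weight z.2 * h (z.1 *m rotation z.2)%R)).
  exact: measurable_rotation_average_kernel.
by move=> z; rewrite mule_ge0// rotation_weight_ge0.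
Qed.

(** Right multiplication of the random matrix by [S^T] preserves its law, and
    turns its rotation [T] into [S T]. *)
Lemma rotation_average_isometry (S : 'M[R]_n) x : (S *m S^T = 1%:M)%R ->
  rotation_average h (x *m S)%R = rotation_average h x.
Proof.
move=> SS; have SS' := mulmx1C SS.
have SST : (S^T *m S^T^T = 1%:M)%R by rewrite trmxK.
pose phi (v : 'rV[R]_N) : 'rV[R]_N := mxvec (vec_mx v *m S^T)%R.
have mphi : measurable_fun setT phi.
  have mG : measurable_fun setT (fun v : 'rV[R]_N => (vec_mx v *m S^T)%R).
    apply: measurable_mxM; last exact: measurable_cst.
    apply: measurable_mx_coord => i j; under eq_fun do rewrite mxE.
    exact: measurable_mx_entry (@measurable_id _ _ _).
  apply: measurable_mx_coord => i j; rewrite ord1.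
  case/mxvec_indexP: j => a b; under eq_fun do rewrite mxvecE.
  exact: measurable_mx_entry.
have phiD : {morph phi : v w / (v + w)%R}.
  by move=> v w; rewrite /phi !linearD/= mulmxDl linearD.
have onto w : exists v, phi v = w.
  exists (mxvec (vec_mx w *m S)%R).
  by rewrite /phi mxvecK -mulmxA SS mulmx1 vec_mxK.
have phin v : enorm (phi v) = enorm v.
  by rewrite /phi enorm_mxvec_isometry// vec_mxK.
have rotphi v : rotation (phi v) = (S *m rotation v)%R.
  by rewrite /rotation /phi mxvecK gram_schmidt_mulmx// trmx_mul trmxK.
have wphi v : rotation_weight (phi v) = rotation_weight v.
  rewrite !rotation_weightE phin rotphi; congr ((nat_of_bool (_ && _))%:R%:E).
  rewrite trmx_mul mulmxA -(mulmxA S).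
  apply/eqP/eqP => [TT|->]; last by rewrite mulmx1.
  set M := (rotation v *m _)%R in TT *.
  rewrite -[M]mulmx1 -SS' -[M]mul1mx -{1}SS'.
  by rewrite mulmxA -(mulmxA S^T) -(mulmxA S^T) TT mulmx1.
transitivity (\int[lebesgue_rV R N]_v
    (rotation_weight (phi v) * h (x *m rotation (phi v))%R)).
  by apply: eq_integral => v _; rewrite wphi rotphi mulmxA.
apply: (integral_lebesgue_rV_isometry
  (h := fun v => rotation_weight v * h (x *m rotation v)%R)) => //.
- exact: measurableT_comp measurable_rotation_average_kernel (measurable_pair1 x).
- by move=> v; rewrite mule_ge0// rotation_weight_ge0.
Qed.

(** The reflection in the hyperplane orthogonal to [x - y]. *)
Lemma reflection_exists (x y : 'rV[R]_n) : enorm x = enorm y ->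
  exists2 S : 'M[R]_n, (S *m S^T = 1%:M)%R & (x *m S = y)%R.
Proof.
move=> xy; have [->|xny] := eqVneq x y.
  by exists 1%:M; rewrite ?trmx1 mulmx1.
pose v := (x - y)%R; pose c := (enorm v ^+ 2)%R.
have c0 : c != 0%R by rewrite expf_neq0// enorm_eq0 subr_eq0.
have vv : (v *m v^T = c%:M)%R by exact: mul_tr_enorm.
have yx : (y *m x^T = x *m y^T)%R.
  apply/matrixP => i j; rewrite !ord1 !mxE; apply: eq_bigr => l _.
  by rewrite !mxE mulrC.
have xv : (2 *: (x *m v^T) = c%:M)%R.
  rewrite -vv /v linearB/= mulmxBl !mulmxBr yx scalerBr.
  by rewrite !mul_tr_enorm xy scaler_nat scaler_nat !mulr2n opprB opprD addrACA.
exists (1%:M - (2 / c) *: (v^T *m v))%R; last first.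
  rewrite mulmxBr mulmx1 -scalemxAr mulmxA mulrC -scalerA scalemxAl xv.
  rewrite mul_scalar_mx scalerA mulVf// scale1r.
  by rewrite /v opprB addrCA subrr addr0.
have vvT : ((v^T *m v)^T = v^T *m v)%R by rewrite trmx_mul trmxK.
have vvvv : ((v^T *m v) *m (v^T *m v) = c *: (v^T *m v))%R.
  by rewrite mulmxA -(mulmxA _ v) vv mul_mx_scalar -scalemxAl.
move: (v^T *m v)%R vvT vvvv => P PT PP.
have -> : ((1%:M - (2 / c) *: P)^T = 1%:M - (2 / c) *: P)%R.
  by rewrite [LHS]linearB/= trmx1 linearZ/= PT.
rewrite mulmxBl mul1mx mulmxBr mulmx1 -scalemxAl -scalemxAr PP !scalerA.
have -> : (2 / c * (2 / c) * c = 2 / c + 2 / c)%R by field.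
by rewrite scalerDl opprB addrK subrK.
Qed.

Lemma rotation_average_enorm x y : enorm x = enorm y ->
  rotation_average h x = rotation_average h y.
Proof.
by move=> /reflection_exists[S SS <-]; rewrite rotation_average_isometry.
Qed.

Lemma integral_rotation_average :
  \int[lebesgue_rV R n]_x rotation_average h x =
  rotation_mass n * \int[lebesgue_rV R n]_x h x.
Proof.
rewrite (fubini_tonelli
  (fun z : 'rV[R]_n * 'rV[R]_N => rotation_weight z.2 * h (z.1 *m rotation z.2)%R));
  last 2 first.
- exact: measurable_rotation_average_kernel.
- by move=> z; rewrite mule_ge0// rotation_weight_ge0.
rewrite -ge0_integralZr//; last 3 first.
- exact: measurable_rotation_weight.
- by move=> v _; exact: rotation_weight_ge0.
- exact: integral_ge0.
apply: eq_integral => v _ /=.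
have mxr : measurable_fun setT (fun x : 'rV[R]_n => (x *m rotation v)%R).
  by apply: measurable_mxM; [exact: measurable_id|exact: measurable_cst].
have mhr : measurable_fun setT (fun x => h (x *m rotation v)%R).
  exact: measurableT_comp mh mxr.
rewrite ge0_integralZl//; last exact: rotation_weight_ge0.
rewrite rotation_weightE; case: andP => [[_ /eqP TT]|_]; last by rewrite !mul0e.
congr (_ * _); apply: (integral_lebesgue_rV_isometry
  (phi := fun x => x *m rotation v)%R) => //.
- by move=> x y; exact: mulmxDl.
- move=> y; exists (y *m (rotation v)^T)%R.
  by rewrite -mulmxA (mulmx1C TT) mulmx1.
- by move=> x; exact: enorm_mul_isometry.
Qed.

End rotation_average.

(** * Radial integrals in different dimensions *)

Section radial.
Context {R : realType}.
Local Open Scope ereal_scope.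

(** The measure of density [|x| ^ (- d)] is invariant under dilations.  As the
    inverse of 0 is 0, the origin has weight 0 when [d] is positive. *)
Definition radial_integral d (f : R -> \bar R) : \bar R :=
  \int[lebesgue_rV R d]_x (((enorm x)^-1 ^+ d)%:E * f (enorm x)).

Let inv_norm_pow_ge0 d (x : 'rV[R]_d) e : (0 <= (enorm x)^-1 ^+ e)%R.
Proof. by rewrite exprn_ge0// invr_ge0 enorm_ge0. Qed.

Let mnorm d : measurable_fun setT (@enorm R d).
Proof. exact: measurable_enorm (@measurable_id _ _ _). Qed.

Let minv_norm d e : measurable_fun setT (fun x : 'rV[R]_d => ((enorm x)^-1 ^+ e)%:E).
Proof.
apply/measurable_EFinP/measurable_funX/measurable_inv_ge0; last exact: mnorm.
exact: enorm_ge0.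
Qed.

Lemma radial_integral_ge0 d (f : R -> \bar R) : (forall t, 0 <= f t) ->
  0 <= radial_integral d f.
Proof. by move=> f0; apply: integral_ge0 => x _; rewrite mule_ge0// lee_fin. Qed.

Lemma radial_integral_dilation d (f : R -> \bar R) (r : R) : (0 < r)%R ->
  measurable_fun setT f -> (forall t, 0 <= f t) ->
  radial_integral d (fun t => f (r * t)%R) = radial_integral d f.
Proof.
move=> r0 mf f0.
have rd0 : (0 < r^-1 ^+ d)%R by rewrite exprn_gt0// invr_gt0.
apply: (muleI_gt0 rd0); rewrite [RHS]muleC.
rewrite /radial_integral -integral_lebesgue_rVZ//; last 2 first.
- by apply: emeasurable_funM => //; exact: measurableT_comp mf (@mnorm d).
- by move=> x; rewrite mule_ge0// lee_fin.
have mfr : measurable_fun setT (fun t => f (r * t)%R).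
  by apply: (measurableT_comp mf); exact: measurable_funM.
rewrite muleC -ge0_integralZl//; last 3 first.
- by apply: emeasurable_funM => //; exact: measurableT_comp mfr (@mnorm d).
- by move=> x _; rewrite mule_ge0// lee_fin.
- by rewrite lee_fin ltW.
apply: eq_integral => x _.
by rewrite enormZ gtr0_norm// invfM exprMn EFinM muleA.
Qed.

(** Both sides equal the double integral of [f (|x| |y|) * b (|x|)] against the
    dilation invariant measures: this is the multiplicative counterpart of
    [translation_invariant_unique]. *)
Lemma radial_integral_unique m n (f b : R -> \bar R) : (0 < m)%N -> (0 < n)%N ->
  measurable_fun setT f -> (forall t, 0 <= f t) ->
  measurable_fun setT b -> (forall t, 0 <= b t) ->
  (forall t, b t^-1%R = b t) ->
  radial_integral m f * radial_integral n b =
  radial_integral n f * radial_integral m b.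
Proof.
move=> m0 n0 mf f0 mb b0 binv.
pose wm (y : 'rV[R]_m) : \bar R := ((enorm y)^-1 ^+ m)%:E.
pose wn (x : 'rV[R]_n) : \bar R := ((enorm x)^-1 ^+ n)%:E.
have wm0 y : 0 <= wm y by rewrite lee_fin.
have wn0 x : 0 <= wn x by rewrite lee_fin.
have mfn : measurable_fun setT (fun x : 'rV[R]_n => f (enorm x)).
  exact: measurableT_comp mf (@mnorm n).
have mbn : measurable_fun setT (fun x : 'rV[R]_n => b (enorm x)).
  exact: measurableT_comp mb (@mnorm n).
have m1 : measurable_fun setT (fun z : 'rV[R]_n * 'rV[R]_m => enorm z.1).
  exact: measurableT_comp (@mnorm n) measurable_fst.
have m2 : measurable_fun setT (fun z : 'rV[R]_n * 'rV[R]_m => enorm z.2).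
  exact: measurableT_comp (@mnorm m) measurable_snd.
have mw1 : measurable_fun setT (fun z : 'rV[R]_n * 'rV[R]_m => wn z.1).
  exact: measurableT_comp (@minv_norm n n) measurable_fst.
have mw2 : measurable_fun setT (fun z : 'rV[R]_n * 'rV[R]_m => wm z.2).
  exact: measurableT_comp (@minv_norm m m) measurable_snd.
pose D (z : 'rV[R]_n * 'rV[R]_m) :=
  wn z.1 * b (enorm z.1) * (wm z.2 * f (enorm z.1 * enorm z.2)%R).
have mD : measurable_fun setT D.
  apply: emeasurable_funM; apply: emeasurable_funM => //.
    exact: measurableT_comp mb m1.
  by apply: (measurableT_comp mf); exact: measurable_funM.
have D0 z : 0 <= D z by rewrite /D !mule_ge0.
pose E (z : 'rV[R]_n * 'rV[R]_m) :=
  wn z.1 * f (enorm z.1) * (wm z.2 * b ((enorm z.1)^-1 * enorm z.2)%R).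
have mE : measurable_fun setT E.
  apply: emeasurable_funM; apply: emeasurable_funM => //.
    exact: measurableT_comp mf m1.
  apply: (measurableT_comp mb); apply: measurable_funM => //.
  by apply: measurable_inv_ge0 => // z; exact: enorm_ge0.
have E0 z : 0 <= E z by rewrite /E !mule_ge0.
transitivity (\int[lebesgue_rV R n]_x \int[lebesgue_rV R m]_y D (x, y)).
  rewrite muleC /radial_integral -ge0_integralZr//; last 3 first.
  - by apply: emeasurable_funM => //; exact: minv_norm.
  - by move=> x _; exact: mule_ge0 (wn0 x) (b0 _).
  - exact: radial_integral_ge0.
  apply: eq_integral => x _; rewrite /D/= ge0_integralZl//; last 3 first.
  - apply: emeasurable_funM; first exact: minv_norm.
    apply: (measurableT_comp mf); apply: measurable_funM => //; exact: mnorm.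
  - by move=> y _; exact: mule_ge0.
  - exact: mule_ge0.
  have [x0|x0] := eqVneq (enorm x) 0%R.
    by rewrite /wn x0 invr0 expr0n gtn_eqF// !mul0e.
  congr (_ * _); rewrite -[LHS](@radial_integral_dilation m f (enorm x))//.
  by rewrite lt_neqAle eq_sym x0 enorm_ge0.
transitivity (\int[lebesgue_rV R n]_x \int[lebesgue_rV R m]_y E (x, y)).
  rewrite (fubini_tonelli D mD D0) (fubini_tonelli E mE E0).
  apply: eq_integral => y _.
  have [y0|y0] := eqVneq (enorm y) 0%R.
    have wy : wm y = 0 by rewrite /wm y0 invr0 expr0n gtn_eqF.
    by apply: eq_integral => x _; rewrite /D /E/= wy !mul0e !mule0.
  have ygt0 : (0 < enorm y)%R by rewrite lt_neqAle eq_sym y0 enorm_ge0.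
  pose K t := wm y * (f t * b (t^-1 * enorm y)%R).
  have K0 t : 0 <= K t by rewrite !mule_ge0.
  have mK : measurable_fun setT K.
    apply: emeasurable_funM => //; apply: emeasurable_funM => //.
    rewrite (_ : (fun _ => _) = fun t => b (t * (enorm y)^-1)%R).
      by apply: (measurableT_comp mb); exact: measurable_funM.
    by apply/funext => t; rewrite -binv invfM invrK.
  transitivity (radial_integral n (fun t => K (enorm y * t)%R)).
    apply: eq_integral => x _; rewrite /D/= /K -!muleA; congr (_ * _).
    have -> : b ((enorm y * enorm x)^-1 * enorm y)%R = b (enorm x).
      by rewrite invfM mulrAC mulVf// mul1r binv.
    by rewrite [LHS]muleC -muleA mulrC.
  rewrite radial_integral_dilation//; apply: eq_integral => x _.
  by rewrite /E/= /K -!muleA; congr (_ * _); rewrite muleCA.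
rewrite /radial_integral -ge0_integralZr//; last 3 first.
- by apply: emeasurable_funM => //; exact: minv_norm.
- by move=> x _; exact: mule_ge0 (wn0 x) (f0 _).
- exact: radial_integral_ge0.
apply: eq_integral => x _; rewrite /E/= ge0_integralZl//; last 3 first.
- apply: emeasurable_funM; first exact: minv_norm.
  by apply: (measurableT_comp mb); apply: measurable_funM => //; exact: mnorm.
- by move=> y _; exact: mule_ge0.
- exact: mule_ge0.
have [x0|x0] := eqVneq (enorm x) 0%R.
  by rewrite /wn x0 invr0 expr0n gtn_eqF// !mul0e.
congr (_ * _); rewrite -[RHS](@radial_integral_dilation m b (enorm x)^-1)//.
by rewrite invr_gt0 lt_neqAle eq_sym x0 enorm_ge0.
Qed.

(** The closed annulus of radii 1/2 and 2 is invariant under inversion and has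
   finite positive measure, so it can serve as the test function [b] above. *)
Let annulus (t : R) : \bar R := (`|t| <= 2)%R%:R%:E * (`|t|^-1 <= 2)%R%:R%:E.

Let annulus_ge0 t : 0 <= annulus t.
Proof. by rewrite mule_ge0// lee_fin. Qed.

Let annulusV t : annulus t^-1%R = annulus t.
Proof. by rewrite /annulus normfV invrK muleC. Qed.

Let measurable_annulus : measurable_fun setT annulus.
Proof.
have mn : measurable_fun setT (fun t : R => `|t|%R).
  exact: measurableT_comp (@normr_measurable R setT) (@measurable_id _ _ _).
by apply: emeasurable_funM; apply: measurable_indic_le => //; exact: measurable_inv_ge0.
Qed.

Let radial_annulus_lty n : radial_integral n annulus < +oo.
Proof.
apply: (@le_lt_trans _ _ ((2 ^+ n)%:E * lebesgue_rV R n [set x | (enorm x <= 2)%R])).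
  rewrite -integral_eball_indic -ge0_integralZl//; last 2 first.
  - exact: measurable_eball_indic.
  - by move=> x _; exact: eball_indic_ge0.
  apply: ge0_le_integral => //.
  - by move=> x _; rewrite mule_ge0// lee_fin.
  - apply: emeasurable_funM; first exact: minv_norm.
    exact: measurableT_comp measurable_annulus (@mnorm n).
  - by apply: emeasurable_funM => //; exact: measurable_eball_indic.
  - move=> x _; rewrite /annulus /eball_indic ger0_norm ?enorm_ge0//.
    rewrite -!EFinM lee_fin; case: (leP (enorm x) 2%R) => _; last by rewrite mul0r !mulr0.
    case: (leP (enorm x)^-1%R 2%R) => x2; last by rewrite mulr0 mulr0 mulr1 exprn_ge0.
    by rewrite !mulr1 lerXn2r ?nnegrE// invr_ge0 enorm_ge0.
by rewrite lebesgue_eball// -EFinM ltry.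
Qed.

Let radial_annulus_gt0 n : (0 < n)%N -> 0 < radial_integral n annulus.
Proof.
move=> n0; rewrite lt_neqAle radial_integral_ge0// andbT; apply/eqP => zero.
have : lebesgue_rV R n [set x | (enorm x <= 2)%R] <=
    (2 ^+ n)%:E * radial_integral n annulus +
    lebesgue_rV R n [set x | (enorm x <= 2^-1)%R].
  rewrite -!integral_eball_indic -ge0_integralZl//; last 2 first.
  - apply: emeasurable_funM; first exact: minv_norm.
    exact: measurableT_comp measurable_annulus (@mnorm n).
  - by move=> x _; rewrite mule_ge0// lee_fin.
  have mG : measurable_fun setT (fun x : 'rV[R]_n =>
      (2 ^+ n)%:E * (((enorm x)^-1 ^+ n)%:E * annulus (enorm x))).
    apply: emeasurable_funM => //; apply: emeasurable_funM; first exact: minv_norm.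
    exact: measurableT_comp measurable_annulus (@mnorm n).
  have G0 (x : 'rV[R]_n) : 0 <= (2 ^+ n)%:E * (((enorm x)^-1 ^+ n)%:E * annulus (enorm x)).
    by rewrite mule_ge0 ?mule_ge0// lee_fin// exprn_ge0.
  rewrite -ge0_integralD//; last 2 first.
  - by move=> x _; exact: eball_indic_ge0.
  - exact: measurable_eball_indic.
  apply: ge0_le_integral => //.
  - by move=> x _; exact: eball_indic_ge0.
  - exact: measurable_eball_indic.
  - by apply: emeasurable_funD => //; exact: measurable_eball_indic.
  - move=> x _; rewrite /eball_indic.
    have [x2|x2] := leP (enorm x) 2%R; last by rewrite adde_ge0// lee_fin.
    have [xh|xh] := leP (enorm x) 2^-1%R; first by rewrite leeDr.
    have xgt0 : (0 < enorm x)%R by rewrite (lt_trans _ xh)// invr_gt0.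
    rewrite adde0 /annulus gtr0_norm// x2 mul1e.
    have -> : ((enorm x)^-1 <= 2)%R by rewrite invf_ple ?posrE// ltW.
    rewrite mule1 -EFinM lee_fin -exprMn exprn_ege1//.
    by rewrite ler_pdivlMr// mul1r.
rewrite -zero mule0 add0e !lebesgue_eball// ?invr_gt0// lee_fin leNgt => /negP; apply.
have half2 : (2^-1 < 2 :> R)%R by lra.
by rewrite ltr_pM2r ?omega_gt0// ltrXn2r ?invr_ge0// gtn_eqF.
Qed.

(** The constant of proportionality is eliminated between two instances of
    [radial_integral_unique] with the same annulus. *)
Lemma radial_integral_proportional m n (f g : R -> \bar R) : (0 < m)%N -> (0 < n)%N ->
  measurable_fun setT f -> (forall t, 0 <= f t) ->
  measurable_fun setT g -> (forall t, 0 <= g t) ->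
  radial_integral m f * radial_integral n g =
  radial_integral n f * radial_integral m g.
Proof.
move=> m0 n0 mf f0 mg g0.
have F := radial_integral_unique m0 n0 mf f0 measurable_annulus annulus_ge0 annulusV.
have G := radial_integral_unique m0 n0 mg g0 measurable_annulus annulus_ge0 annulusV.
have fin : radial_integral n annulus \is a fin_num.
  by rewrite ge0_fin_numE ?radial_integral_ge0.
have pos : (0 < fine (radial_integral n annulus))%R.
  by rewrite fine_gt0// radial_annulus_gt0// radial_annulus_lty.
apply: (muleI_gt0 pos); rewrite fineK//.
rewrite muleAC F -!muleA; congr (_ * _).
by rewrite G muleC.
Qed.

Definition ball_moment m k : \bar R :=
  \int[lebesgue_rV R m]_y ((enorm y ^+ k)%:E * eball_indic 1 y).

Let radial_integral_weighted m k (f : R -> \bar R) : (0 < k)%N ->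
  radial_integral m (fun t => (`|t| ^+ (m + k))%:E * f t) =
  \int[lebesgue_rV R m]_y ((enorm y ^+ k)%:E * f (enorm y)).
Proof.
move=> k0; apply: eq_integral => y _; rewrite muleA ger0_norm ?enorm_ge0//.
rewrite -EFinM exprD mulrA; congr (_%:E * _).
have [->|y0] := eqVneq (enorm y) 0%R.
  by rewrite !expr0n (gtn_eqF k0) !mulr0.
by rewrite -exprMn mulVf// expr1n mul1r.
Qed.

Let radial_integral_self n (f : R -> \bar R) : (0 < n)%N ->
  measurable_fun setT f -> (forall t, 0 <= f t) ->
  radial_integral n (fun t => (`|t| ^+ n)%:E * f t) =
  \int[lebesgue_rV R n]_x f (enorm x).
Proof.
move=> n0 mf f0.
have mF : measurable_fun setT (fun t : R => (`|t| ^+ n)%:E * f t).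
  apply: emeasurable_funM => //; apply/measurable_EFinP/measurable_funX.
  exact: measurableT_comp (@normr_measurable R setT) (@measurable_id _ _ _).
apply: ge0_ae_eq_integral => //.
- apply: emeasurable_funM; first exact: minv_norm.
  exact: measurableT_comp mF (@mnorm n).
- exact: measurableT_comp mf (@mnorm n).
- by move=> x _; rewrite mule_ge0 ?mule_ge0// lee_fin// exprn_ge0.
exists [set 0%R]; split.
- rewrite (_ : [set 0%R] = [set x : 'rV[R]_n | (enorm x <= 0)%R]).
    exact: measurable_eball.
  apply/seteqP; split=> x /=; first by move=> ->; rewrite enorm0.
  by move=> x0; apply/eqP; rewrite -enorm_eq0 eq_le x0 enorm_ge0.
- exact: lebesgue_rV_set1.
- move=> x /=; apply: contra_notP => /eqP x0 _.
  rewrite ger0_norm ?enorm_ge0// muleA -EFinM -exprMn mulVf ?enorm_eq0//.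
  by rewrite expr1n mul1e.
Qed.

(** Both integrals are homogeneous of degree [m + k] under dilations, so they agree
    on radial functions up to a constant, which is found on the unit balls. *)
Lemma radial_integral_change_dim m k (f : R -> \bar R) : (0 < m)%N -> (0 < k)%N ->
  measurable_fun setT f -> (forall t, 0 <= f t) ->
  \int[lebesgue_rV R m]_y ((enorm y ^+ k)%:E * f (enorm y)) * (omega R (m + k))%:E =
  \int[lebesgue_rV R (m + k)]_x f (enorm x) * ball_moment m k.
Proof.
move=> m0 k0 mf f0; have n0 : (0 < m + k)%N by rewrite addn_gt0 m0.
pose b (t : R) : \bar R := (t <= 1)%R%:R%:E.
have mb : measurable_fun setT b by exact: measurable_indic_le.
have b0 t : 0 <= b t by rewrite lee_fin.
have mp : measurable_fun setT (fun t : R => (`|t| ^+ (m + k))%:E).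
  apply/measurable_EFinP/measurable_funX.
  exact: measurableT_comp (@normr_measurable R setT) (@measurable_id _ _ _).
have p0 (t : R) : 0 <= (`|t| ^+ (m + k))%:E :> \bar R by rewrite lee_fin exprn_ge0.
have := @radial_integral_proportional m (m + k)
  (fun t => (`|t| ^+ (m + k))%:E * f t) (fun t => (`|t| ^+ (m + k))%:E * b t) m0 n0
  (emeasurable_funM mp mf) (fun t => mule_ge0 (p0 t) (f0 t))
  (emeasurable_funM mp mb) (fun t => mule_ge0 (p0 t) (b0 t)).
rewrite !radial_integral_weighted// !radial_integral_self//.
by rewrite [X in _ * X = _]integral_eball_indic lebesgue_eball1.
Qed.

Let moment_integrand_ge0 m k (y : 'rV[R]_m) :
  0 <= (enorm y ^+ k)%:E * eball_indic 1 y.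
Proof.
apply: mule_ge0; last exact: eball_indic_ge0.
by rewrite lee_fin exprn_ge0// enorm_ge0.
Qed.

Lemma ball_moment_lty m k : ball_moment m k < +oo.
Proof.
apply: le_lt_trans (@lebesgue_eball_lty R m 1); rewrite -integral_eball_indic.
apply: ge0_le_integral => //.
- apply: emeasurable_funM; last exact: measurable_eball_indic.
  by apply/measurable_EFinP/measurable_funX; exact: mnorm.
- exact: measurable_eball_indic.
- move=> y _; rewrite /eball_indic -EFinM lee_fin.
  by case: (leP (enorm y) 1%R) => y1; rewrite ?mulr0// mulr1 exprn_ile1// enorm_ge0.
Qed.

Lemma ball_moment_gt0 m k : (0 < m)%N -> 0 < ball_moment m k.
Proof.
move=> m0; have P0 (y : 'rV[R]_m) := @moment_integrand_ge0 m k y.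
have mP : measurable_fun setT (fun y : 'rV[R]_m => (enorm y ^+ k)%:E * eball_indic 1 y).
  apply: emeasurable_funM; last exact: measurable_eball_indic.
  by apply/measurable_EFinP/measurable_funX; exact: mnorm.
have mb := @measurable_eball_indic R m.
rewrite lt_neqAle integral_ge0// andbT; apply/eqP => zero.
have : lebesgue_rV R m [set x | (enorm x <= 1)%R] <=
    (2 ^+ k)%:E * ball_moment m k + lebesgue_rV R m [set x | (enorm x <= 2^-1)%R].
  rewrite -!integral_eball_indic -ge0_integralZl// -ge0_integralD//; last 3 first.
  - by move=> x _; rewrite mule_ge0.
  - exact: emeasurable_funM.
  - by move=> x _; exact: eball_indic_ge0.
  apply: ge0_le_integral => //.
  - by move=> x _; exact: eball_indic_ge0.
  - by apply: emeasurable_funD => //; exact: emeasurable_funM.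
  - move=> x _.
    have [xh|xh] := leP (enorm x) 2^-1%R.
      apply: (@le_trans _ _ 1).
        by rewrite /eball_indic; case: (leP (enorm x) 1%R); rewrite lee_fin.
      by rewrite {2}/eball_indic xh leeDr// mule_ge0.
    rewrite {3}/eball_indic [(enorm x <= 2^-1)%R]leNgt xh adde0 muleA -EFinM -exprMn.
    rewrite /eball_indic lee_fin ler_peMl// exprn_ege1//.
    by rewrite mulrC -ler_pdivrMr// mul1r ltW.
rewrite -zero mule0 add0e lebesgue_eball1 lebesgue_eball// ?invr_gt0//.
rewrite lee_fin leNgt => /negP; apply.
by rewrite gtr_pMl ?omega_gt0// exprn_ilt1 ?gtn_eqF// ?invr_ge0//; lra.
Qed.

End radial.

(** * Averages of integrals over rotated subspaces *)

Section rotated_sections.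
Context {R : realType}.
Local Open Scope ereal_scope.

Lemma enorm_delta n (i : 'I_n) : enorm (delta_mx 0%R i : 'rV[R]_n) = 1%R.
Proof.
rewrite /enorm (bigD1 i)//= mxE !eqxx expr1n big1 ?addr0 ?sqrtr1// => j ji.
by rewrite mxE (negbTE ji) andbF expr0n.
Qed.

(** The average over the rotations turns [h] into a radial function, for which
    [radial_integral_change_dim] compares the two dimensions; averaging does not
    change the integral of [h] over the whole space. *)
Lemma integral_rotated_section m k n (U : 'M[R]_(m, n)) (h : 'rV[R]_n -> \bar R) :
  (m + k)%N = n -> (0 < m)%N -> (0 < k)%N -> (U *m U^T = 1%:M)%R ->
  measurable_fun setT h -> (forall x, 0 <= h x) ->
  \int[lebesgue_rV R (n * n)]_v (rotation_weight v *
    \int[lebesgue_rV R m]_y ((enorm y ^+ k)%:E * h (y *m U *m rotation v)%R)) *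
  (omega R n)%:E =
  rotation_mass n * \int[lebesgue_rV R n]_x h x * ball_moment m k.
Proof.
move=> mkn m0 k0 UU mh h0.
have w0 (v : 'rV[R]_(n * n)) : 0 <= rotation_weight v by exact: rotation_weight_ge0.
have mw : measurable_fun setT (@rotation_weight R n).
  exact: measurable_rotation_weight.
have mp : measurable_fun setT (fun y : 'rV[R]_m => (enorm y ^+ k)%:E).
  apply/measurable_EFinP/measurable_funX.
  exact: measurable_enorm (@measurable_id _ _ _).
have p0 (y : 'rV[R]_m) : 0 <= (enorm y ^+ k)%:E.
  by rewrite lee_fin exprn_ge0// enorm_ge0.
have mhr : measurable_fun setT (fun z : 'rV[R]_(n * n) * 'rV[R]_m =>
    h (z.2 *m U *m rotation z.1)%R).
  apply: (measurableT_comp mh); apply: measurable_mxM.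
    by apply: measurable_mxM; [exact: measurable_snd|exact: measurable_cst].
  exact: measurableT_comp (@measurable_rotation R n) measurable_fst.
pose D (z : 'rV[R]_(n * n) * 'rV[R]_m) := rotation_weight z.1 *
  ((enorm z.2 ^+ k)%:E * h (z.2 *m U *m rotation z.1)%R).
have mD : measurable_fun setT D.
  apply: emeasurable_funM; first exact: measurableT_comp mw measurable_fst.
  by apply: emeasurable_funM => //; exact: measurableT_comp mp measurable_snd.
have D0 z : 0 <= D z by rewrite /D !mule_ge0.
pose e : 'rV[R]_n := (delta_mx 0 (Ordinal m0) *m U)%R.
have e1 : enorm e = 1%R by rewrite enorm_mul_isometry// enorm_delta.
pose chi (t : R) := rotation_average h (t *: e)%R.
have chiE p (x : 'rV[R]_p) (y : 'rV[R]_n) : enorm y = enorm x ->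
    rotation_average h y = chi (enorm x).
  move=> yx; apply: rotation_average_enorm => //.
  by rewrite enormZ e1 mulr1 ger0_norm ?enorm_ge0.
have mchi : measurable_fun setT chi.
  apply: (measurableT_comp (measurable_rotation_average mh h0)).
  by apply: measurable_mxZ; [exact: measurable_id|exact: measurable_cst].
have chi0 t : 0 <= chi t by exact: rotation_average_ge0.
transitivity (\int[lebesgue_rV R m]_y ((enorm y ^+ k)%:E * chi (enorm y)) *
    (omega R n)%:E).
  congr (_ * _).
  transitivity (\int[lebesgue_rV R (n * n)]_v \int[lebesgue_rV R m]_y D (v, y)).
    apply: eq_integral => v _; rewrite /D/= ge0_integralZl//.
    - apply: emeasurable_funM => //.
      exact: measurableT_comp mhr (measurable_pair1 v).
    - by move=> y _; rewrite mule_ge0.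
  rewrite (fubini_tonelli D mD D0); apply: eq_integral => y _.
  rewrite -(chiE _ y (y *m U)%R) ?enorm_mul_isometry//.
  rewrite -ge0_integralZl//; last 2 first.
  - apply: emeasurable_funM => //.
    exact: measurableT_comp mhr (measurable_pair2 y).
  - by move=> v _; rewrite mule_ge0.
  by apply: eq_integral => v _; rewrite /D/= muleCA.
rewrite -integral_rotation_average//.
have := radial_integral_change_dim m0 k0 mchi chi0; rewrite mkn => ->.
have -> : \int[lebesgue_rV R n]_x rotation_average h x =
    \int[lebesgue_rV R n]_x chi (enorm x).
  by apply: eq_integral => x _; exact: chiE.
by [].
Qed.

End rotated_sections.

(** * Measurability on the Grassmannian *)

Section matrix_continuity.
Context {R : realType}.

Lemma continuous_mx_entries (T : topologicalType) m n (f : T -> 'M[R]_(m, n)) :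
  (forall i j, continuous (fun t => f t i j)) -> continuous f.
Proof.
move=> cf t; apply/cvg_ballP => e e0.
have : \forall s \near t, forall ij : 'I_m * 'I_n,
    ball (f t ij.1 ij.2) e (f s ij.1 ij.2).
  by apply: filter_forall => -[i j] /=; have /cvg_ballP := cf i j t; exact.
by apply: filterS => s fs; split=> [//|i j]; exact: fs (i, j).
Qed.

Lemma continuous_mulmxl m n p (B : 'M[R]_(n, p)) :
  continuous (fun A : 'M[R]_(m, n) => A *m B).
Proof.
apply: continuous_mx_entries => i j.
rewrite (_ : (fun _ => _) = fun A : 'M[R]_(m, n) => \sum_l A i l * B l j); last first.
  by apply/funext => A; rewrite mxE.
apply: continuous_big => //; first exact: add_continuous.
move=> l _ A.
exact: cvgM (@coord_continuous R m n i l A) (cvg_cst _).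
Qed.

Lemma continuous_enorm_residual m n (x : 'rV[R]_n) (z : 'rV[R]_m) :
  continuous (fun A : 'M[R]_(m, n) => enorm (x - z *m A)).
Proof.
move=> A; apply: (@continuous_comp _ _ _
  (fun A : 'M[R]_(m, n) => \sum_i (x - z *m A) 0 i ^+ 2) Num.sqrt); last first.
  exact: sqrt_continuous.
move: A; apply: continuous_big => //; first exact: add_continuous.
move=> i _ A; under eq_fun do rewrite expr2.
suff ci : {for A, continuous (fun A : 'M[R]_(m, n) => (x - z *m A) 0 i)}.
  by exact: (cvgM ci ci).
rewrite (_ : (fun _ => _) =
    fun A : 'M[R]_(m, n) => x 0 i - \sum_l z 0 l * A l i); last first.
  by apply/funext => B; rewrite !mxE.
have cs : continuous (fun A : 'M[R]_(m, n) => \sum_l z 0 l * A l i).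
  apply: continuous_big => //; first exact: add_continuous.
  by move=> l _ B; exact: cvgM (cvg_cst _) (@coord_continuous R m n l i B).
exact: cvgB (cvg_cst _) (cs A).
Qed.

End matrix_continuity.

Section projector.
Context {R : realType} (n k : nat).
Implicit Types F : Gr R n k.
Local Notation m := (n - k)%N.

Definition Gr_projector F : 'M[R]_n := (orthonormal_frame F)^T *m orthonormal_frame F.

Lemma frame_isometry F : orthonormal_frame F *m (orthonormal_frame F)^T = 1%:M.
Proof. exact: (orthonormal_frameP F).1. Qed.

Lemma mulmx_frame_projector F (y : 'rV[R]_m) :
  y *m orthonormal_frame F *m Gr_projector F = y *m orthonormal_frame F.
Proof. by rewrite -mulmxA (mulmxA (orthonormal_frame F)) frame_isometry mul1mx. Qed.

(** By orthogonality of [x - x P] and the subspace. *)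
Lemma enorm_projector_le F (x : 'rV[R]_n) (y : 'rV[R]_m) :
  enorm (x - x *m Gr_projector F) <= enorm (x - y *m orthonormal_frame F).
Proof.
set O := orthonormal_frame F; set P := Gr_projector F.
pose a := x - x *m P; pose b := (x *m O^T - y) *m O.
have -> : x - y *m O = a + b.
  by rewrite /a /b mulmxBl -mulmxA addrA subrK.
have aO : a *m O^T = 0.
  by rewrite mulmxBl -!mulmxA frame_isometry mulmx1 subrr.
have ab : a *m b^T = 0 by rewrite trmx_mul mulmxA aO mul0mx.
have ba : b *m a^T = 0 by rewrite -[LHS]trmxK trmx_mul trmxK ab trmx0.
rewrite -(@ler_pXn2r _ 2) ?nnegrE ?enorm_ge0//.
suff -> : enorm (a + b) ^+ 2 = enorm a ^+ 2 + enorm b ^+ 2.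
  by rewrite lerDl exprn_ge0// enorm_ge0.
have /matrixP/(_ 0 0) : (enorm (a + b) ^+ 2)%:M =
    (enorm a ^+ 2)%:M + (enorm b ^+ 2)%:M :> 'M[R]_1.
  by rewrite -!mul_tr_enorm linearD/= mulmxDl !mulmxDr ab ba addr0 add0r.
by rewrite !mxE !mulr1n.
Qed.

(** The distance from [x] to the row span of a matrix [A] is less than [r] exactly
    when [|x - z A| < r] for some [z]: the subspaces at distance less than [r] form
    an open set of the quotient topology, as a union of open conditions on [A]. *)
Lemma measurable_dist_Gr (x : 'rV[R]_n) :
  measurable_fun setT (fun F => enorm (x - x *m Gr_projector F) : R).
Proof.
apply: (measurability _ (RGenInftyO.measurableE R)).
move=> _ [_ [r ->] <-]; rewrite setTI; apply: sub_sigma_algebra.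
rewrite (_ : _ @^-1` _ = [set F | enorm (x - x *m Gr_projector F) < r]); last first.
  by apply/seteqP; split=> F /=; rewrite in_itv.
pose V z : set 'M[R]_(m, n) := [set A | \dim (rowspan A) = m] `&`
  [set A | enorm (x - z *m A) < r].
suff oV : open (\bigcup_z V z).
  change (Gr_open [set F | enorm (x - x *m Gr_projector F) < r]).
  move: oV; rewrite /Gr_open; congr open; apply/seteqP; split.
    move=> A [z _ [dimA zr]].
    exists (exist _ (rowspan A) (introT eqP dimA)) => //=.
    set F : Gr R n k := exist _ _ _.
    have [y zy] : exists y, z *m A = y *m orthonormal_frame F.
      apply/rowspanP; rewrite (orthonormal_frameP F).2.
      by apply/rowspanP; exists z.
    by apply: le_lt_trans zr; rewrite zy; exact: enorm_projector_le.
  move=> A [F Fr AF].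
  have [y xPy] : exists y, x *m Gr_projector F = y *m A.
    apply/rowspanP; rewrite AF -(orthonormal_frameP F).2.
    by apply/rowspanP; exists (x *m (orthonormal_frame F)^T); rewrite mulmxA.
  exists y => //; split; first by rewrite /= AF dim_Gr.
  by rewrite /= -xPy.
apply: bigcup_open => z _; apply: openI; first exact: full_rank_open.
apply: (@open_comp _ _ (fun A : 'M[R]_(m, n) => enorm (x - z *m A)) [set t | t < r]).
  by move=> A _; exact: continuous_enorm_residual.
exact: open_lt.
Qed.

Lemma enorm_dist_projector F (x : 'rV[R]_n) :
  (x *m Gr_projector F *m x^T) 0 0 =
  enorm x ^+ 2 - enorm (x - x *m Gr_projector F) ^+ 2.
Proof.
set P := Gr_projector F.
have PT : P^T = P by rewrite trmx_mul trmxK.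
have PP : P *m P = P.
  by rewrite /P mulmxA -(mulmxA _ _ (orthonormal_frame F)^T) frame_isometry mulmx1.
clearbody P.
have /matrixP/(_ 0 0) : x *m P *m x^T =
    (enorm x ^+ 2)%:M - (enorm (x - x *m P) ^+ 2)%:M.
  rewrite -!mul_tr_enorm linearB/= trmx_mul PT mulmxBl !mulmxBr.
  by rewrite !mulmxA -(mulmxA x P P) PP subrr subr0 opprB addrC subrK.
by rewrite !mxE !mulr1n.
Qed.

(** The quadratic form of the projection is [|x| ^ 2] minus the squared distance
    to the subspace, and a symmetric matrix is determined by its quadratic form. *)
Lemma measurable_projector : measurable_fun setT Gr_projector.
Proof.
have mq (x : 'rV[R]_n) :
    measurable_fun setT (fun F => (x *m Gr_projector F *m x^T) 0 0 : R).
  under eq_fun do rewrite enorm_dist_projector.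
  by apply: measurable_funB => //; apply: measurable_funX; exact: measurable_dist_Gr.
apply: measurable_mx_coord => i j.
pose e l : 'rV[R]_n := delta_mx 0 l.
have entry F a b : Gr_projector F a b = (e a *m Gr_projector F *m (e b)^T) 0 0.
  by rewrite -rowE trmx_delta -colE !mxE.
have PT F : (Gr_projector F)^T = Gr_projector F by rewrite trmx_mul trmxK.
rewrite (_ : (fun _ => _) = fun F => 2^-1 *
    (((e i + e j) *m Gr_projector F *m (e i + e j)^T) 0 0
     - (e i *m Gr_projector F *m (e i)^T) 0 0
     - (e j *m Gr_projector F *m (e j)^T) 0 0)); last first.
  apply/funext => F; rewrite linearD/= !mulmxDl !mulmxDr.
  rewrite [X in 2^-1 * (X - _ - _)]mxE [X in 2^-1 * (X + _ - _ - _)]mxE.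
  rewrite [X in 2^-1 * (_ + X - _ - _)]mxE -!entry.
  have -> : Gr_projector F j i = Gr_projector F i j.
    by rewrite -{1}PT mxE.
  by field.
by apply: measurable_funM => //; apply: measurable_funB => //; exact: measurable_funB.
Qed.

End projector.

Section subspace_integrals.
Context {R : realType} (n k : nat).
Implicit Types F : Gr R n k.
Local Notation m := (n - k)%N.
Local Open Scope ereal_scope.

(** Two orthonormal bases of a subspace differ by an isometry. *)
Lemma integral_frame_independent F (U : 'M[R]_(m, n)) (H : 'rV[R]_n -> \bar R) :
  (U *m U^T = 1%:M)%R -> rowspan U = F ->
  measurable_fun setT H -> (forall x, 0 <= H x) ->
  \int[lebesgue_rV R m]_y H (y *m U)%R =
  \int[lebesgue_rV R m]_y H (y *m orthonormal_frame F)%R.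
Proof.
move=> UU UF mH H0; set O := orthonormal_frame F.
have UO : (U *m O^T *m O = U)%R.
  apply/row_matrixP => i; rewrite !row_mul.
  have /rowspanP[z ->] : row i U \in rowspan O.
    rewrite (orthonormal_frameP F).2 -UF.
    by apply/rowspanP; exists (delta_mx 0%R i); rewrite rowE.
  by rewrite -(mulmxA z) frame_isometry mulmx1.
pose Q := (U *m O^T)%R.
have QQ : (Q *m Q^T = 1%:M)%R by rewrite /Q trmx_mul trmxK mulmxA UO UU.
have mQ : measurable_fun setT (fun y : 'rV[R]_m => (y *m Q)%R).
  by apply: measurable_mxM; [exact: measurable_id|exact: measurable_cst].
have mHO : measurable_fun setT (fun y : 'rV[R]_m => H (y *m O)%R).
  apply: (measurableT_comp mH).
  by apply: measurable_mxM; [exact: measurable_id|exact: measurable_cst].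
rewrite -[RHS](integral_lebesgue_rV_isometry mQ)//.
- by apply: eq_integral => y _; rewrite -(mulmxA y) UO.
- by move=> x y; exact: mulmxDl.
- by move=> y; exists (y *m Q^T)%R; rewrite -mulmxA (mulmx1C QQ) mulmx1.
- by move=> x; exact: enorm_mul_isometry.
Qed.

Lemma integral_Gr_act F (T : 'M[R]_n) (H : 'rV[R]_n -> \bar R) :
  (T *m T^T = 1%:M)%R -> measurable_fun setT H -> (forall x, 0 <= H x) ->
  \int[lebesgue_rV R m]_y H (y *m orthonormal_frame (Gr_act T F))%R =
  \int[lebesgue_rV R m]_y H (y *m orthonormal_frame F *m T)%R.
Proof.
move=> TT mH H0; rewrite -(@integral_frame_independent _ (orthonormal_frame F *m T)%R)//.
- by apply: eq_integral => y _; rewrite mulmxA.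
- by rewrite trmx_mul mulmxA -(mulmxA (orthonormal_frame F)) TT mulmx1 frame_isometry.
- rewrite Gr_actE//; apply/vspaceP => x; apply/rowspanP/memv_imgP => [[y ->]|].
    exists (y *m orthonormal_frame F)%R; last by rewrite lfunE/= mulmxA.
    by rewrite -(orthonormal_frameP F).2; apply/rowspanP; exists y.
  move=> [z + ->]; rewrite -(orthonormal_frameP F).2 => /rowspanP[y ->].
  by exists y; rewrite lfunE/= mulmxA.
Qed.

Lemma measurable_Gr_act (T : 'M[R]_n) : (T *m T^T = 1%:M)%R ->
  measurable_fun setT (@Gr_act R n k T).
Proof.
move=> TT; apply: (measurability (@open (Gr R n k))) => //.
move=> _ [U oU <-]; rewrite setTI; apply: sub_sigma_algebra.
have spanT (A : 'M[R]_(m, n)) F : rowspan A = F -> rowspan (A *m T)%R = Gr_act T F.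
  move=> AF; rewrite Gr_actE//; apply/vspaceP => x; apply/rowspanP/memv_imgP => [[y ->]|].
    exists (y *m A)%R; last by rewrite lfunE/= mulmxA.
    by rewrite -AF; apply/rowspanP; exists y.
  move=> [z + ->]; rewrite -AF => /rowspanP[y ->].
  by exists y; rewrite lfunE/= mulmxA.
change (Gr_open (Gr_act T @^-1` U)); change (Gr_open U) in oU.
have := @open_comp _ _ (fun A : 'M[R]_(m, n) => (A *m T)%R) _
  (fun A _ => @continuous_mulmxl R m n n T A) oU.
rewrite /Gr_open; congr open; apply/seteqP; split=> A /=; last first.
  by move=> [F UF AF]; exists (Gr_act T F) => //; exact: spanT.
move=> [G UG AG].
have dimA : \dim (rowspan A) == m.
  rewrite dim_rowspan; have := introT eqP (dim_Gr G).
  by rewrite -AG dim_rowspan trmx_mul mulmxA -(mulmxA A) TT mulmx1.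
exists (exist _ (rowspan A) dimA) => //=.
rewrite (_ : Gr_act _ _ = G)//; apply: val_inj.
by apply: etrans AG; exact/esym/spanT.
Qed.

Definition slab (P : 'M[R]_n) (x : 'rV[R]_n) : \bar R :=
  (enorm (x - x *m P) <= 1)%R%:R%:E.

Definition slab_volume (P : 'M[R]_n) : \bar R :=
  \int[lebesgue_rV R n]_x (slab P x * eball_indic 1 (x *m P)%R).

Lemma slab_ge0 P x : 0 <= slab P x. Proof. by rewrite lee_fin. Qed.

Lemma measurable_slab d (T : measurableType d) (P : T -> 'M[R]_n) :
  measurable_fun setT P ->
  measurable_fun setT (fun z : T * 'rV[R]_n => slab (P z.1) z.2).
Proof.
move=> mP; apply: measurable_indic_le => //; apply: measurable_enorm.
apply: measurable_mxB; first exact: measurable_snd.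
by apply: measurable_mxM; [exact: measurable_snd|exact: measurableT_comp mP measurable_fst].
Qed.

Lemma measurable_slab1 (P : 'M[R]_n) : measurable_fun setT (slab P).
Proof.
exact: measurableT_comp (@measurable_slab _ unit (fun=> P) (measurable_cst _))
  (measurable_pair1 tt).
Qed.

Lemma measurable_mulmx_param d (T : measurableType d) (P : T -> 'M[R]_n) :
  measurable_fun setT P ->
  measurable_fun setT (fun z : T * 'rV[R]_n => (z.2 *m P z.1)%R).
Proof.
move=> mP.
by apply: measurable_mxM; [exact: measurable_snd|exact: measurableT_comp mP measurable_fst].
Qed.

Lemma measurable_slab_volume d (T : measurableType d) (P : T -> 'M[R]_n) :
  measurable_fun setT P -> measurable_fun setT (fun t => slab_volume (P t)).
Proof.
move=> mP; apply: (measurable_fun_fubini_tonelli_F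
  (fun z : T * 'rV[R]_n => slab (P z.1) z.2 * eball_indic 1 (z.2 *m P z.1)%R)).
  apply: emeasurable_funM; first exact: measurable_slab.
  exact: measurableT_comp (@measurable_eball_indic R n 1) (measurable_mulmx_param mP).
by move=> z; apply: mule_ge0; [exact: slab_ge0|exact: eball_indic_ge0].
Qed.

(** The slab is invariant under translations by vectors of the subspace, so
    [translation_invariant_unique] applies to the coordinates of the projection.
    Only the projection matrix occurs on the right and in the volume: this gives
    the measurability of the left-hand integral as a function of [F]. *)
Lemma integral_frame_slab F (H : 'rV[R]_n -> \bar R) :
  measurable_fun setT H -> (forall x, 0 <= H x) ->
  \int[lebesgue_rV R m]_y H (y *m orthonormal_frame F)%R * slab_volume (Gr_projector F) =
  (omega R m)%:E * \int[lebesgue_rV R n]_x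
    (slab (Gr_projector F) x * H (x *m Gr_projector F)%R).
Proof.
move=> mH H0; set O := orthonormal_frame F; set P := Gr_projector F.
have mphi : measurable_fun setT (fun x : 'rV[R]_n => (x *m O^T)%R).
  by apply: measurable_mxM; [exact: measurable_id|exact: measurable_cst].
have mw : measurable_fun setT (slab P) by exact: measurable_slab1.
have mh : measurable_fun setT (fun y : 'rV[R]_m => H (y *m O)%R).
  apply: (measurableT_comp mH).
  by apply: measurable_mxM; [exact: measurable_id|exact: measurable_cst].
have := @translation_invariant_unique R n m (fun x => x *m O^T)%R (slab P)
  (@eball_indic R m 1) (fun y => H (y *m O)%R) mphi (fun x y => mulmxDl x y O^T) mw
  (slab_ge0 P) (@measurable_eball_indic R m 1) (@eball_indic_ge0 R m 1) mh
  (fun=> H0 _).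
rewrite integral_eball_indic lebesgue_eball1 => E.
rewrite /slab_volume.
have -> : \int[lebesgue_rV R n]_x (slab P x * eball_indic 1 (x *m P)%R) =
    \int[lebesgue_rV R n]_x (slab P x * eball_indic 1 (x *m O^T)%R).
  apply: eq_integral => x _; rewrite /eball_indic -(@enorm_mul_isometry _ _ _ _ O).
    by rewrite /P /Gr_projector mulmxA.
  exact: frame_isometry.
rewrite -E; last 2 first.
- move=> v; exists (v *m O)%R; first by rewrite -mulmxA frame_isometry mulmx1.
  move=> x; rewrite /slab mulmxDl mulmx_frame_projector opprD addrACA subrr addr0.
  by [].
- by move=> y; rewrite /eball_indic enormN.
by congr (_ * _); apply: eq_integral => x _; rewrite /P /Gr_projector mulmxA.
Qed.

Lemma enorm_mul_projector_le F (x : 'rV[R]_n) :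
  (enorm (x *m Gr_projector F) <= enorm x)%R.
Proof.
have le : (enorm (x *m (orthonormal_frame F)^T) ^+ 2 <= enorm x ^+ 2)%R.
  have : ((enorm (x *m (orthonormal_frame F)^T) ^+ 2)%:M =
      x *m Gr_projector F *m x^T :> 'M[R]_1)%R.
    by rewrite -mul_tr_enorm trmx_mul trmxK !mulmxA.
  move=> /matrixP/(_ 0%R 0%R); rewrite mxE mulr1n => ->.
  by rewrite enorm_dist_projector gerBl exprn_ge0// enorm_ge0.
rewrite mulmxA enorm_mul_isometry ?frame_isometry//.
by rewrite -(@ler_pXn2r _ 2) ?nnegrE ?enorm_ge0.
Qed.

Lemma slab_volume_gt0 F : 0 < slab_volume (Gr_projector F).
Proof.
apply: (@lt_le_trans _ _ (omega R n)%:E); first by rewrite lte_fin omega_gt0.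
rewrite -lebesgue_eball1 -integral_eball_indic; apply: ge0_le_integral => //.
- by move=> x _; exact: eball_indic_ge0.
- exact: measurable_eball_indic.
- apply: emeasurable_funM; first exact: measurable_slab1.
  apply: (measurableT_comp (@measurable_eball_indic R n 1)).
  by apply: measurable_mxM; [exact: measurable_id|exact: measurable_cst].
move=> x _; rewrite /eball_indic; have [x1|_] := leP (enorm x) 1%R; last first.
  by apply: mule_ge0; [exact: slab_ge0|rewrite lee_fin].
have -> : slab (Gr_projector F) x = 1.
  rewrite /slab; suff -> : (enorm (x - x *m Gr_projector F) <= 1)%R by [].
  by apply: le_trans x1; have := enorm_projector_le F x 0%R; rewrite mul0mx subr0.
by rewrite (le_trans (enorm_mul_projector_le F x) x1) mul1e.
Qed.

Lemma slab_volume_lty F : slab_volume (Gr_projector F) < +oo.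
Proof.
apply: (@le_lt_trans _ _ (lebesgue_rV R n (cube n 2))); last first.
  by rewrite lebesgue_cube// ltry.
rewrite -[X in lebesgue_rV R n X]setIT -integral_indic//; last exact: measurable_cube.
apply: ge0_le_integral => //.
- by move=> x _; apply: mule_ge0; [exact: slab_ge0|exact: eball_indic_ge0].
- apply: emeasurable_funM; first exact: measurable_slab1.
  apply: (measurableT_comp (@measurable_eball_indic R n 1)).
  by apply: measurable_mxM; [exact: measurable_id|exact: measurable_cst].
- by apply/measurable_EFinP; apply: measurable_indic; exact: measurable_cube.
move=> x _; rewrite /slab /eball_indic indicE -EFinM lee_fin.
have [x1|_] := leP (enorm (x - x *m Gr_projector F)) 1%R; last by rewrite mul0r.
have [x2|_] := leP (enorm (x *m Gr_projector F)) 1%R; last by rewrite mulr0.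
suff xc : cube n 2 x by rewrite mem_set// mulr1.
move=> i; rewrite -(subrK (x *m Gr_projector F) x) mxE.
rewrite (le_trans (ler_normD _ _))// (_ : 2 = 1 + 1 :> R)%R//.
by apply: lerD; apply: le_trans (ler_coord_enorm _ i) _.
Qed.

(** The parameter [t] is needed to apply Fubini's theorem to families of functions
    and of subspaces at the same time. *)
Lemma measurable_Gr_integral d (T : measurableType d) (G : T -> Gr R n k)
    (H : T * 'rV[R]_n -> \bar R) :
  measurable_fun setT G -> measurable_fun setT H -> (forall z, 0 <= H z) ->
  measurable_fun setT (fun t =>
    \int[lebesgue_rV R m]_y H (t, (y *m orthonormal_frame (G t))%R)).
Proof.
move=> mG mH H0.
have mP : measurable_fun setT (fun t => Gr_projector (G t)).
  exact: measurableT_comp (@measurable_projector R n k) mG.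
pose c t := fine (slab_volume (Gr_projector (G t))).
have c0 t : (0 < c t)%R by rewrite fine_gt0// slab_volume_gt0 slab_volume_lty.
have mHt t : measurable_fun setT (fun x => H (t, x)).
  exact: measurableT_comp mH (measurable_pair1 t).
pose K (z : T * 'rV[R]_n) := slab (Gr_projector (G z.1)) z.2 *
  H (z.1, (z.2 *m Gr_projector (G z.1))%R).
have mK : measurable_fun setT K.
  apply: emeasurable_funM; first exact: (measurable_slab mP).
  apply: (measurableT_comp mH); apply: measurable_fun_pair => /=.
    exact: measurable_fst.
  exact: (measurable_mulmx_param mP).
have K0 z : 0 <= K z by apply: mule_ge0 => //; exact: slab_ge0.
rewrite (_ : (fun _ => _) = fun t => (c t)^-1%:E *
    ((omega R m)%:E * \int[lebesgue_rV R n]_x K (t, x))); last first.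
  apply/funext => t; apply: (muleI_gt0 (c0 t)).
  rewrite muleAC -EFinM mulVf ?gt_eqF// mul1e.
  rewrite fineK ?ge0_fin_numE ?slab_volume_lty// ?ltW ?slab_volume_gt0//.
  by rewrite (@integral_frame_slab (G t) (fun x => H (t, x))).
apply: emeasurable_funM.
  apply/measurable_EFinP/measurable_inv_ge0 => [t|]; first exact: ltW.
  exact: measurableT_comp (@fine_measurable R setT measurableT) (measurable_slab_volume mP).
by apply: emeasurable_funM => //; exact: (measurable_fun_fubini_tonelli_F K mK K0).
Qed.

End subspace_integrals.

Section moment_averages.
Context {R : realType} (n k : nat).
Implicit Types F : Gr R n k.
Local Notation m := (n - k)%N.
Hypotheses (k0 : (0 < k)%N) (kn : (k < n)%N).
Variable h : 'rV[R]_n -> \bar R.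
Hypotheses (mh : measurable_fun setT h) (h0 : forall x, (0 <= h x)%E).
Local Open Scope ereal_scope.

Definition moment_integral F : \bar R :=
  \int[lebesgue_rV R m]_y ((enorm y ^+ k)%:E * h (y *m orthonormal_frame F)%R).

Let Hk (x : 'rV[R]_n) : \bar R := (enorm x ^+ k)%:E * h x.

Let Hk0 x : 0 <= Hk x.
Proof. by rewrite mule_ge0// lee_fin exprn_ge0// enorm_ge0. Qed.

Let mHk : measurable_fun setT Hk.
Proof.
apply: emeasurable_funM => //; apply/measurable_EFinP/measurable_funX.
exact: measurable_enorm (@measurable_id _ _ _).
Qed.

Let moment_integralE F : moment_integral F =
  \int[lebesgue_rV R m]_y Hk (y *m orthonormal_frame F)%R.
Proof.
by apply: eq_integral => y _; rewrite /Hk enorm_mul_isometry// frame_isometry.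
Qed.

Lemma moment_integral_ge0 F : 0 <= moment_integral F.
Proof. by rewrite moment_integralE integral_ge0. Qed.

Lemma measurable_moment_integral : measurable_fun setT moment_integral.
Proof.
rewrite (_ : moment_integral = fun F =>
  \int[lebesgue_rV R m]_y Hk (y *m orthonormal_frame F)%R); last first.
  exact/funext/moment_integralE.
apply: (@measurable_Gr_integral R n k _ _ id (fun z => Hk z.2)) => //.
exact: measurableT_comp mHk measurable_snd.
Qed.

Let moment_integral_rotated F v :
  rotation_weight v * moment_integral (Gr_act (rotation v) F) =
  rotation_weight v * \int[lebesgue_rV R m]_y
    ((enorm y ^+ k)%:E * h (y *m orthonormal_frame F *m rotation v)%R).
Proof.
rewrite rotation_weightE; case: andP => [[_ /eqP TT]|_]; last by rewrite !mul0e.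
rewrite !mul1e moment_integralE (integral_Gr_act F TT mHk Hk0).
apply: eq_integral => y _.
by rewrite /Hk enorm_mul_isometry// enorm_mul_isometry// frame_isometry.
Qed.

Lemma measurable_rotated_moment : measurable_fun setT
  (fun z : 'rV[R]_(n * n) * Gr R n k =>
    rotation_weight z.1 * moment_integral (Gr_act (rotation z.1) z.2)).
Proof.
pose H (t : ('rV[R]_(n * n) * Gr R n k) * 'rV[R]_n) :=
  (enorm t.2 ^+ k)%:E * h (t.2 *m rotation t.1.1)%R.
rewrite (_ : (fun _ => _) = fun z => rotation_weight z.1 *
    \int[lebesgue_rV R m]_y H (z, (y *m orthonormal_frame z.2)%R)); last first.
  apply/funext => z; rewrite moment_integral_rotated.
  apply: (congr1 (fun a => rotation_weight z.1 * a)); apply: eq_integral => y _.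
  by rewrite /H/= enorm_mul_isometry// frame_isometry.
apply: emeasurable_funM.
  exact: measurableT_comp (@measurable_rotation_weight R n) measurable_fst.
apply: measurable_Gr_integral; first exact: measurable_snd.
  apply: emeasurable_funM.
    apply/measurable_EFinP/measurable_funX.
    exact: measurable_enorm measurable_snd.
  apply: (measurableT_comp mh); apply: measurable_mxM; first exact: measurable_snd.
  apply: (measurableT_comp (@measurable_rotation R n)).
  exact: measurableT_comp measurable_fst measurable_fst.
by move=> t; rewrite mule_ge0// lee_fin exprn_ge0// enorm_ge0.
Qed.

Lemma average_rotated_moment F :
  \int[lebesgue_rV R (n * n)]_v
    (rotation_weight v * moment_integral (Gr_act (rotation v) F)) * (omega R n)%:E =
  rotation_mass n * \int[lebesgue_rV R n]_x h x * ball_moment m k.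
Proof.
have mkn : (m + k = n)%N by rewrite subnK// ltnW.
have m0 : (0 < m)%N by rewrite subn_gt0.
apply: etrans (integral_rotated_section mkn m0 k0 (frame_isometry F) mh h0).
apply: (congr1 (fun a => a * (omega R n)%:E)).
by apply: eq_integral => v _; exact: moment_integral_rotated.
Qed.

Lemma integral_haar_Gr_act (nu : probability (Gr R n k) R) (T : 'M[R]_n)
    (f : Gr R n k -> \bar R) :
  is_haar nu -> (T *m T^T = 1%:M)%R ->
  measurable_fun setT f -> (forall F, 0 <= f F) ->
  \int[nu]_F f (Gr_act T F) = \int[nu]_F f F.
Proof.
move=> haar TT mf f0.
transitivity (\int[pushforward nu (Gr_act T)]_F f F).
  by rewrite [RHS]ge0_integral_pushforward//; exact: measurable_Gr_act.
pose act_fun : {mfun Gr R n k >-> Gr R n k} :=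
  HB.pack (Gr_act T)
    (isMeasurableFun.Build _ _ _ _ (@Gr_act R n k T) (measurable_Gr_act TT)).
transitivity (\int[image_measure nu act_fun]_F f F); first by [].
by apply: eq_measure_integral => A mA _; exact: haar.
Qed.

(** Averaging the invariance of [nu] over the rotations reduces the integral over
    the Grassmannian to the average over the rotations of a fixed subspace. *)
Lemma integral_haar_moment (nu : probability (Gr R n k) R) : is_haar nu ->
  \int[nu]_F moment_integral F * (omega R n)%:E =
  \int[lebesgue_rV R n]_x h x * ball_moment m k.
Proof.
move=> haar; have mm := measurable_moment_integral.
have mw : measurable_fun setT (@rotation_weight R n) by exact: measurable_rotation_weight.
have w0 (v : 'rV[R]_(n * n)) : 0 <= rotation_weight v by exact: rotation_weight_ge0.
have mass_fin : (rotation_mass n : \bar R) \is a fin_num.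
  by rewrite ge0_fin_numE ?rotation_mass_lty// ltW ?rotation_mass_gt0.
have mass_pos : (0 < fine (rotation_mass n : \bar R))%R.
  by rewrite fine_gt0// rotation_mass_lty rotation_mass_gt0.
apply: (muleI_gt0 mass_pos); rewrite (fineK mass_fin).
pose D (z : 'rV[R]_(n * n) * Gr R n k) :=
  rotation_weight z.1 * moment_integral (Gr_act (rotation z.1) z.2).
have D0 z : 0 <= D z by rewrite mule_ge0// moment_integral_ge0.
have mD : measurable_fun setT D by exact: measurable_rotated_moment.
transitivity ((\int[lebesgue_rV R (n * n)]_v \int[nu]_F D (v, F)) * (omega R n)%:E).
  rewrite [LHS]muleAC; congr (_ * _).
  have I0 : 0 <= \int[nu]_F moment_integral F.
    by apply: integral_ge0 => F _; exact: moment_integral_ge0.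
  rewrite muleC /rotation_mass -ge0_integralZr//.
  apply: eq_integral => v _; rewrite /D/=.
  rewrite rotation_weightE; case: andP => [[_ /eqP TT]|_]; last first.
    by rewrite mul0e integral0_eq// => F _; rewrite mul0e.
  rewrite mul1e; under [RHS]eq_integral => F _ do rewrite mul1e.
  by rewrite (integral_haar_Gr_act haar TT mm moment_integral_ge0).
rewrite (fubini_tonelli D mD D0) -ge0_integralZr//; last 3 first.
- exact: (measurable_fun_fubini_tonelli_G D mD D0).
- by move=> F _; exact: integral_ge0.
- by rewrite lee_fin ltW// omega_gt0.
under eq_integral => F _ do rewrite average_rotated_moment.
rewrite integral_cst//.
rewrite [X in _ * X = _](_ : _ = 1); last exact: probability_setT.
by rewrite mule1 [RHS]muleC muleA.
Qed.

End moment_averages.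

(** * Concentrating the mass near the origin *)

Section bathtub.
Context {R : realType}.
Local Open Scope ereal_scope.

Lemma ball_moment_scale m k (r : R) : (0 < r)%R ->
  \int[lebesgue_rV R m]_y ((enorm y ^+ k)%:E * eball_indic r y) =
  (r ^+ (m + k))%:E * ball_moment m k.
Proof.
move=> r0; have mn : measurable_fun setT (@enorm R m).
  exact: measurable_enorm (@measurable_id _ _ _).
pose G (y : 'rV[R]_m) : \bar R := (enorm y ^+ k)%:E * eball_indic r y.
have mG : measurable_fun setT G.
  apply: emeasurable_funM; last exact: measurable_eball_indic.
  exact/measurable_EFinP/measurable_funX.
have G0 y : 0 <= G y.
  apply: mule_ge0; last exact: eball_indic_ge0.
  by rewrite lee_fin exprn_ge0// enorm_ge0.
have rm0 : (0 < r^-1 ^+ m)%R by rewrite exprn_gt0// invr_gt0.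
apply: (muleI_gt0 rm0); rewrite muleC -(integral_lebesgue_rVZ r0 mG G0).
rewrite muleAC -EFinM exprD mulrAC -exprMn divff ?gt_eqF// expr1n mul1r.
rewrite /ball_moment -ge0_integralZl//; last 3 first.
- apply: emeasurable_funM; last exact: measurable_eball_indic.
  exact/measurable_EFinP/measurable_funX.
- move=> y _; apply: mule_ge0; last exact: eball_indic_ge0.
  by rewrite lee_fin exprn_ge0// enorm_ge0.
- by rewrite lee_fin exprn_ge0// ltW.
apply: eq_integral => y _; rewrite /G /eball_indic enormZ gtr0_norm//.
rewrite exprMn EFinM muleA; congr (_ * (nat_of_bool _)%:R%:E).
by rewrite mulrC -ler_pdivlMr// divff// gt_eqF.
Qed.

(** Infinite values above [M] let a bound by the essential supremum be used on
    every subspace, although subspaces are null sets of [R ^ n]. *)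
Definition penalized (M t : R) : \bar R := t%:E + +oo * (M < t)%R%:R%:E.

Lemma penalized_ge0 M t : (0 <= t)%R -> 0 <= penalized M t.
Proof. by move=> t0; rewrite adde_ge0// ?lee_fin// mule_ge0// lee_fin. Qed.

Lemma penalized_le M t : (t <= M)%R -> penalized M t = t%:E.
Proof. by move=> tM; rewrite /penalized ltNge tM mule0 adde0. Qed.

Lemma penalized_gt M t : (M < t)%R -> penalized M t = +oo.
Proof. by move=> tM; rewrite /penalized tM mule1 addey. Qed.

Lemma measurable_penalized M d (T : measurableType d) (f : T -> R) :
  measurable_fun setT f -> measurable_fun setT (fun t => penalized M (f t)).
Proof.
move=> mf; apply: emeasurable_funD; first exact/measurable_EFinP.
apply: emeasurable_funM => //; apply/measurable_EFinP.
rewrite (_ : (fun _ => _) = \1_[set t | (M < f t)%R]); last first.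
  apply/funext => t; rewrite indicE; congr ((nat_of_bool _)%:R).
  by apply/idP/idP; rewrite inE.
apply: measurable_indic.
rewrite (_ : [set t | _] = ~` (setT `&` [set t | (f t <= M)%R])); last first.
  apply/seteqP; split=> t /=; rewrite ?ltNge; first by move=> /negP tM [_ /tM].
  by move=> /not_andP[//|/negP].
by apply: measurableC; exact: measurable_fun_le.
Qed.

(** Among the densities bounded by [M] of given mass, [M] times the indicator of
    a centered ball has the least moment.  If [r] is the radius of that ball, then
    [(|y| ^ k - r ^ k) * (q y - M * 1_(|y| <= r))] is nonnegative. *)
Lemma bathtub m k (M s : R) (q : 'rV[R]_m -> R) :
  (0 < m)%N -> (0 < k)%N -> (0 < M)%R ->
  measurable_fun setT q -> (forall y, 0 <= q y)%R ->
  \int[lebesgue_rV R m]_y (q y)%:E = s%:E ->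
  (M * (s / (M * omega R m)) `^ ((m + k)%:R / m%:R))%R%:E * ball_moment m k <=
  \int[lebesgue_rV R m]_y ((enorm y ^+ k)%:E * penalized M (q y)).
Proof.
move=> m0 k0 M0 mq q0 qs.
have mn : measurable_fun setT (@enorm R m).
  exact: measurable_enorm (@measurable_id _ _ _).
have mR0 : (m%:R != 0 :> R)%R by rewrite pnatr_eq0 -lt0n.
have w0 := omega_gt0 (R := R) m.
have s0 : (0 <= s)%R.
  by rewrite -lee_fin -qs; apply: integral_ge0 => y _; rewrite lee_fin.
have pen0 y : 0 <= penalized M (q y) by exact: penalized_ge0.
have pow0 (y : 'rV[R]_m) : 0 <= (enorm y ^+ k)%:E.
  by rewrite lee_fin exprn_ge0// enorm_ge0.
move: s0; rewrite le_eqVlt => /predU1P[<-|s0].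
  rewrite mul0r powR0 ?mulr0 ?mul0e; last first.
    by rewrite mulf_neq0 ?invr_eq0// pnatr_eq0 -lt0n addn_gt0 m0.
  by apply: integral_ge0 => y _; rewrite mule_ge0.
pose t := (s / (M * omega R m))%R.
have t0 : (0 < t)%R by rewrite divr_gt0// mulr_gt0.
pose r := (t `^ m%:R^-1)%R.
have r0 : (0 < r)%R by rewrite powR_gt0.
have rm : (r ^+ m = t)%R.
  by rewrite -powR_mulrn ?ltW// -powRrM mulVf// powRr1// ltW.
have -> : (t `^ ((m + k)%:R / m%:R) = r ^+ (m + k))%R.
  by rewrite -[RHS]powR_mulrn ?ltW// -powRrM mulrC.
have sE : (s = M * omega R m * r ^+ m)%R.
  by rewrite rm /t mulrC divfK// gt_eqF// mulr_gt0.
have mpow : measurable_fun setT (fun y : 'rV[R]_m => (enorm y ^+ k)%:E).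
  exact/measurable_EFinP/measurable_funX.
have mpen : measurable_fun setT (fun y => penalized M (q y)).
  exact: measurable_penalized.
have meb := @measurable_eball_indic R m r.
have eb0 (y : 'rV[R]_m) : 0 <= eball_indic r y by exact: eball_indic_ge0.
have mqE : measurable_fun setT (fun y => (q y)%:E) by exact/measurable_EFinP.
have Mr0 : 0 <= (M * r ^+ k)%:E by rewrite lee_fin mulr_ge0 ?ltW// exprn_gt0.
have rk0 : 0 <= (r ^+ k)%:E by rewrite lee_fin exprn_ge0// ltW.
have ME0 : 0 <= M%:E by rewrite lee_fin ltW.
have m1 : measurable_fun setT
    (fun y : 'rV[R]_m => M%:E * ((enorm y ^+ k)%:E * eball_indic r y)).
  by apply: emeasurable_funM => //; exact: emeasurable_funM.
have m2 : measurable_fun setT (fun y : 'rV[R]_m => (r ^+ k)%:E * (q y)%:E).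
  exact: emeasurable_funM.
have m3 : measurable_fun setT (fun y : 'rV[R]_m => (enorm y ^+ k)%:E * penalized M (q y)).
  exact: emeasurable_funM.
have m4 : measurable_fun setT (fun y : 'rV[R]_m => (M * r ^+ k)%:E * eball_indic r y).
  exact: emeasurable_funM.
have : \int[lebesgue_rV R m]_y
    (M%:E * ((enorm y ^+ k)%:E * eball_indic r y) + (r ^+ k)%:E * (q y)%:E) <=
    \int[lebesgue_rV R m]_y
    ((enorm y ^+ k)%:E * penalized M (q y) + (M * r ^+ k)%:E * eball_indic r y).
  apply: ae_ge0_le_integral => //.
  - by move=> y _; rewrite adde_ge0// !mule_ge0// lee_fin.
  - exact: emeasurable_funD.
  - by move=> y _; rewrite adde_ge0// mule_ge0.
  - exact: emeasurable_funD.
  (* At the origin the weight [|y| ^ k] does not see the penalty. *)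
  exists [set 0%R]; split.
  - rewrite (_ : [set 0%R] = [set x : 'rV[R]_m | (enorm x <= 0)%R]).
      exact: measurable_eball.
    apply/seteqP; split=> x /=; first by move=> ->; rewrite enorm0.
    by move=> x0; apply/eqP; rewrite -enorm_eq0 eq_le x0 enorm_ge0.
  - exact: lebesgue_rV_set1.
  move=> y /=; apply: contra_notP => /eqP; rewrite -enorm_eq0 => yneq0 _.
  have y0 : (0 < enorm y)%R by rewrite lt_neqAle eq_sym yneq0 enorm_ge0.
  have [qM|qM] := leP (q y) M; last first.
    by rewrite penalized_gt// gt0_muley ?lte_fin ?exprn_gt0// addye ?leey// -EFinM.
  rewrite penalized_le// /eball_indic -!EFinM lee_fin.
  have [yr|yr] := leP (enorm y) r; rewrite ?mulr1 ?mulr0 ?add0r ?addr0.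
    have yk : (enorm y ^+ k <= r ^+ k)%R by rewrite lerXn2r ?nnegrE ?enorm_ge0// ltW.
    rewrite -subr_ge0; have -> : (enorm y ^+ k * q y + M * r ^+ k -
      (M * enorm y ^+ k + r ^+ k * q y) = (r ^+ k - enorm y ^+ k) * (M - q y))%R by ring.
    by rewrite mulr_ge0// subr_ge0.
  by rewrite ler_wpM2r// lerXn2r ?nnegrE ?enorm_ge0// ltW.
have kap0 (y : 'rV[R]_m) : 0 <= (enorm y ^+ k)%:E * eball_indic r y.
  exact: mule_ge0.
have n1 (y : 'rV[R]_m) : 0 <= M%:E * ((enorm y ^+ k)%:E * eball_indic r y).
  exact: mule_ge0.
have n2 y : 0 <= (r ^+ k)%:E * (q y)%:E by rewrite mule_ge0// lee_fin.
have n3 y : 0 <= (enorm y ^+ k)%:E * penalized M (q y) by exact: mule_ge0.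
have n4 (y : 'rV[R]_m) : 0 <= (M * r ^+ k)%:E * eball_indic r y by exact: mule_ge0.
rewrite (ge0_integralD _ measurableT (fun y _ => n1 y) m1 (fun y _ => n2 y) m2).
rewrite (ge0_integralD _ measurableT (fun y _ => n3 y) m3 (fun y _ => n4 y) m4).
have -> : \int[lebesgue_rV R m]_y (M%:E * ((enorm y ^+ k)%:E * eball_indic r y)) =
    (M * r ^+ (m + k))%:E * ball_moment m k.
  rewrite (ge0_integralZl _ measurableT _ (fun y _ => kap0 y))//.
    by rewrite (ball_moment_scale _ _ r0) muleA -EFinM.
  exact: emeasurable_funM.
have -> : \int[lebesgue_rV R m]_y ((r ^+ k)%:E * (q y)%:E) =
    \int[lebesgue_rV R m]_y ((M * r ^+ k)%:E * eball_indic r y).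
  rewrite (ge0_integralZl _ measurableT meb (fun y _ => eb0 y))//.
  rewrite integral_eball_indic (lebesgue_eball _ r0).
  rewrite (ge0_integralZl _ measurableT mqE)//; last by move=> y _; rewrite lee_fin.
  by rewrite qs -!EFinM sE; congr EFin; ring.
have fin4 : \int[lebesgue_rV R m]_y ((M * r ^+ k)%:E * eball_indic r y) \is a fin_num.
  rewrite (ge0_integralZl _ measurableT meb (fun y _ => eb0 y))//.
  by rewrite integral_eball_indic (lebesgue_eball _ r0).
by rewrite leeD2rE.
Qed.

End bathtub.

(** * The slicing inequality *)

Section densities.
Context {R : realType}.
Local Open Scope ereal_scope.

Lemma integral_bounded_lty d (T : measurableType d) (mu : {measure set T -> \bar R})
    (A : set T) (g : T -> R) (M : R) :
  measurable A -> measurable_fun setT g -> (forall x, 0 <= g x <= M)%R ->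
  mu A < +oo -> \int[mu]_(x in A) (g x)%:E < +oo.
Proof.
move=> mA mg gM muA; apply: (@le_lt_trans _ _ (\int[mu]_(x in A) (cst M%:E) x)).
  apply: ge0_le_integral => //.
  - by move=> x _; rewrite lee_fin; case/andP: (gM x).
  - by apply/measurable_EFinP; exact: measurable_funS mg.
  - by move=> x _; rewrite lee_fin; case/andP: (gM x).
rewrite integral_cst// lte_mul_pinfty// lee_fin.
by have /andP[] := gM point; exact: le_trans.
Qed.

Lemma Rintegral_setB d (T : measurableType d) (mu : {measure set T -> \bar R})
    (K L : set T) (g : T -> R) :
  measurable K -> measurable L -> L `<=` K ->
  measurable_fun setT g -> (forall x, 0 <= g x)%R ->
  \int[mu]_(x in K) (g x)%:E < +oo ->
  ((\int[mu]_(x in K) g x - \int[mu]_(x in L) g x)%R)%:E =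
  \int[mu]_(x in K `\` L) (g x)%:E.
Proof.
move=> mK mL LK mg g0 fin.
have mgE D : measurable_fun D (EFin \o g).
  by apply/measurable_EFinP; exact: measurable_funS mg.
have split : \int[mu]_(x in K) (g x)%:E =
    \int[mu]_(x in L) (g x)%:E + \int[mu]_(x in K `\` L) (g x)%:E.
  rewrite -{1}(setDUK LK) ge0_integral_setU//.
  - exact: measurableD.
  - by move=> x _; rewrite lee_fin.
  - by apply/disj_setPS => x [Lx [_ /(_ Lx)]].
have I0 D : 0 <= \int[mu]_(x in D) (g x)%:E.
  by apply: integral_ge0 => x _; rewrite lee_fin.
have finL : \int[mu]_(x in L) (g x)%:E \is a fin_num.
  rewrite ge0_fin_numE//; apply: le_lt_trans fin.
  by rewrite split leeDl.
have finK : \int[mu]_(x in K) (g x)%:E \is a fin_num by rewrite ge0_fin_numE.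
by rewrite /Rintegral EFinB (fineK finK) (fineK finL) split addeAC subee// add0e.
Qed.

Lemma bounded_set_norm n (K : set 'rV[R]_n) : bounded_set K ->
  exists B : R, forall x, K x -> (enorm x <= B)%R.
Proof.
move=> [B [_ KB]]; exists (n%:R * (B + 1))%R => x Kx; apply: enorm_le_coord => i.
have := KB (B + 1)%R; rewrite ltrDl ltr01 => /(_ isT x Kx) /=; apply: le_trans.
have -> : `|x|%R = mx_norm x by [].
rewrite mx_normrE.
exact: (le_bigmax _ (fun ij : 'I_1 * 'I_n => `|x ij.1 ij.2|%R) (0%R, i)).
Qed.



Variables (n k : nat) (K L : set 'rV[R]_n) (g : 'rV[R]_n -> R).
Hypotheses (mK : measurable K) (mL : measurable L) (bK : bounded_set K) (LK : L `<=` K)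
  (mg : measurable_fun setT g) (g0 : forall x, (0 <= g x)%R)
  (g_bounded : exists M : R, forall x, (g x <= M)%R).

Definition shell_density (x : 'rV[R]_n) : R := (g x * \1_(K `\` L) x)%R.

Lemma shell_density_ge0 x : (0 <= shell_density x)%R.
Proof. by rewrite mulr_ge0. Qed.

Lemma shell_density_le x : (shell_density x <= g x)%R.
Proof. by rewrite ler_piMr// indicE; case: (_ \in _). Qed.

Lemma measurable_shell_density : measurable_fun setT shell_density.
Proof.
by apply: measurable_funM => //; apply: measurable_indic; exact: measurableD.
Qed.

Let integral_shell (mu : {measure set 'rV[R]_n -> \bar R}) (D : set 'rV[R]_n) :
  \int[mu]_(x in (K `\` L) `&` D) (g x)%:E = \int[mu]_(x in D) (shell_density x)%:E.
Proof.
rewrite setIC integral_mkcondr; apply: eq_integral => x _.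
rewrite /shell_density patchE indicE; case: (x \in _); first by rewrite mulr1.
by rewrite mulr0.
Qed.

Let density_lty (mu : {measure set 'rV[R]_n -> \bar R}) (A : set 'rV[R]_n) :
  measurable A -> mu A < +oo -> \int[mu]_(x in A) (g x)%:E < +oo.
Proof.
move=> mA muA; have [M gM] := g_bounded.
by apply: (@integral_bounded_lty _ _ _ _ _ M) => // x; rewrite g0 gM.
Qed.

Lemma density_measureB : ((density_measure g K - density_measure g L)%R)%:E =
  \int[lebesgue_rV R n]_x (shell_density x)%:E.
Proof.
have [B KB] := bounded_set_norm bK.
rewrite /density_measure Rintegral_setB//.
  by rewrite -[in LHS](setIT (K `\` L)) integral_shell.
apply: density_lty => //; apply: le_lt_trans (lebesgue_eball_lty n B).
by apply: le_measure; rewrite ?inE//; exact: measurable_eball.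
Qed.

Lemma measurable_subspace (F : Gr R n k) :
  measurable [set x | x \in (F : {vspace 'rV[R]_n})].
Proof.
rewrite (_ : [set x | _] = [set x | (enorm (x - x *m Gr_projector F) <= 0)%R]).
  rewrite -[X in measurable X]setTI; apply: measurable_fun_le => //.
  apply: measurable_enorm; apply: measurable_mxB; first exact: measurable_id.
  by apply: measurable_mxM; [exact: measurable_id|exact: measurable_cst].
apply/seteqP; split=> x /=.
  rewrite -(orthonormal_frameP F).2 => /rowspanP[y ->].
  by rewrite mulmx_frame_projector subrr enorm0.
move=> x0; have : x == (x *m Gr_projector F)%R.
  by rewrite -subr_eq0 -enorm_eq0 eq_le x0 enorm_ge0.
move=> /eqP ->; rewrite -(orthonormal_frameP F).2; apply/rowspanP.
by exists (x *m (orthonormal_frame F)^T)%R; rewrite mulmxA.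
Qed.

Lemma section_measureB (F : Gr R n k) :
  ((section_measure g K F - section_measure g L F)%R)%:E =
  \int[lebesgue_rV R (n - k)]_y (shell_density (y *m orthonormal_frame F))%:E.
Proof.
have [B KB] := bounded_set_norm bK.
have mF := measurable_subspace F.
set V := [set x | _] in mF.
have mO : measurable_fun setT (@Gr_isometry R n k F) by exact: measurable_funPT.
have isoV : @Gr_isometry R n k F @^-1` V = setT.
  apply/seteqP; split=> // y _; rewrite /V /= -(orthonormal_frameP F).2.
  by apply/rowspanP; exists y.
rewrite /section_measure Rintegral_setB//.
- rewrite (_ : (K `&` V) `\` (L `&` V) = (K `\` L) `&` V); last first.
    apply/seteqP; split=> x /=.
      by move=> [[Kx Vx] nLV]; split=> //; split=> // Lx; exact: nLV.
    by move=> [[Kx nLx] Vx]; split=> // -[].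
  rewrite integral_shell.
  rewrite [LHS](@ge0_integral_pushforward _ _ _ _ _ (@Gr_isometry R n k F))//.
    by rewrite isoV.
  - by apply/measurable_EFinP; apply: measurable_funS measurable_shell_density.
  - by move=> x _; rewrite lee_fin shell_density_ge0.
- exact: measurableI.
- exact: measurableI.
- exact: setSI.
- apply: density_lty; first exact: measurableI.
  apply: le_lt_trans (lebesgue_eball_lty (n - k) B).
  change (lebesgue_rV R (n - k) (@Gr_isometry R n k F @^-1` (K `&` V)) <=
    lebesgue_rV R (n - k) [set y | (enorm y <= B)%R]).
  apply: le_measure; rewrite ?inE.
  + rewrite -[X in measurable X]setTI; apply: mO => //; exact: measurableI.
  + exact: measurable_eball.
  by move=> y [/KB]; rewrite /Gr_isometry enorm_mul_isometry// frame_isometry.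
Qed.

(** Only almost everywhere, whence the penalized densities below. *)
Lemma shell_density_le_norm : (0 < Linf_norm g)%R ->
  {ae lebesgue_rV R n, forall x, (shell_density x <= Linf_norm g)%R}.
Proof.
move=> norm_gt0.
have normE : 'N[lebesgue_rV R n]_+oo[EFin \o g] = (Linf_norm g)%:E.
  by move: norm_gt0; rewrite /Linf_norm; case: ('N[_]_+oo[_]) => //=; rewrite ltxx.
move: normE; rewrite unlock /Lnorm; case: ifPn => [_ supE|_ [zero]]; last first.
  by rewrite -zero ltxx in norm_gt0.
have := ess_sup_ge (lebesgue_rV R n) (abse \o (EFin \o g)).
rewrite supE; apply: filterS => x /=; rewrite lee_fin.
by apply: le_trans; rewrite (le_trans (shell_density_le x))// ler_norm.
Qed.

End densities.

Section slicing.
Context {R : realType}.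

(** The final passage to the power [m / n], with [wn] and [wm] the volumes of the
    unit balls. *)
Lemma powR_scaling (n m k : nat) (M wn wm J a : R) :
  (0 < m)%N -> (m + k)%N = n -> 0 < M -> 0 < wn -> 0 < wm -> 0 <= J ->
  M * (M * wm)^-1 `^ (n%:R / m%:R) * wn * J <= a ->
  wn `^ (m%:R / n%:R) / wm * (1 / M `^ (k%:R / n%:R)) * J `^ (m%:R / n%:R)
    <= a `^ (m%:R / n%:R).
Proof.
move=> m0 mkn M0 wn0 wm0 J0 Ja.
have n0 : (0 < n)%N by rewrite -mkn addn_gt0 m0.
have mR : m%:R != 0 :> R by rewrite pnatr_eq0 -lt0n.
have nR : n%:R != 0 :> R by rewrite pnatr_eq0 -lt0n.
have X0 : 0 < (M * wm)^-1 by rewrite invr_gt0 mulr_gt0.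
have Xp : 0 < (M * wm)^-1 `^ (n%:R / m%:R) by rewrite powR_gt0.
apply: (@le_trans _ _
    ((M * (M * wm)^-1 `^ (n%:R / m%:R) * wn * J) `^ (m%:R / n%:R))); last first.
  have A0 : 0 <= M * (M * wm)^-1 `^ (n%:R / m%:R) * wn * J.
    by rewrite !mulr_ge0// ltW.
  by apply: ge0_ler_powR => //; rewrite ?nnegrE//; exact: le_trans Ja.
have M0' := ltW M0; have wn0' := ltW wn0; have Xp' := ltW Xp.
rewrite !powRM ?mulr_ge0// -powRrM.
have -> : n%:R / m%:R * (m%:R / n%:R) = 1 :> R by field; rewrite mR nR.
rewrite powRr1 ?(ltW X0)//.
have -> : M `^ (m%:R / n%:R) = M / M `^ (k%:R / n%:R).
  rewrite -{2}[M](@powRr1 _ M) ?ltW// -powRB; last by rewrite (gt_eqF M0) implybT.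
  by congr (_ `^ _); rewrite -mkn natrD; field; rewrite -natrD mkn.
have Mk : M `^ (k%:R / n%:R) != 0 by rewrite gt_eqF// powR_gt0.
rewrite le_eqVlt; apply/orP; left; apply/eqP; field.
by rewrite Mk !gt_eqF.
Qed.

Section moments.
Variables (n k : nat) (K L : set 'rV[R]_n) (g : 'rV[R]_n -> R).
Hypotheses (k0 : (0 < k)%N) (kn : (k < n)%N).
Hypotheses (mK : measurable K) (mL : measurable L) (bK : bounded_set K) (LK : L `<=` K)
  (mg : measurable_fun setT g) (g0 : forall x, 0 <= g x)
  (g_bounded : exists M : R, forall x, g x <= M) (g_norm : 0 < Linf_norm g).
Local Notation m := (n - k)%N.
Local Notation M := (Linf_norm g).
Local Notation shell := (shell_density K L g).
Local Open Scope ereal_scope.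

Definition shell_mass : R := (density_measure g K - density_measure g L)%R.
Definition shell_section (F : Gr R n k) : R :=
  (section_measure g K F - section_measure g L F)%R.
Let h (x : 'rV[R]_n) : \bar R := penalized M (shell x).

Let n0 : (0 < n)%N. Proof. exact: ltn_trans kn. Qed.
Let m0 : (0 < m)%N. Proof. by rewrite subn_gt0. Qed.
Let mkn : (m + k = n)%N. Proof. by rewrite subnK// ltnW. Qed.

Let h0 x : 0 <= h x.
Proof. by apply: penalized_ge0; exact: shell_density_ge0. Qed.

Let mh : measurable_fun setT h.
Proof. by apply: measurable_penalized; exact: measurable_shell_density. Qed.

Let integral_h : \int[lebesgue_rV R n]_x h x = shell_mass%:E.
Proof.
rewrite /shell_mass density_measureB//; apply: ge0_ae_eq_integral => //.
- by apply/measurable_EFinP; exact: measurable_shell_density.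
- by move=> x _; rewrite lee_fin shell_density_ge0.
have := shell_density_le_norm K L g0 g_norm.
by apply: filterS => x xM _; exact: penalized_le.
Qed.

Lemma shell_section_ge0 F : (0 <= shell_section F)%R.
Proof.
rewrite -lee_fin section_measureB//; apply: integral_ge0 => y _.
by rewrite lee_fin shell_density_ge0.
Qed.

Lemma measurable_shell_section : measurable_fun setT shell_section.
Proof.
apply/measurable_EFinP.
rewrite (_ : _ \o _ = fun F => \int[lebesgue_rV R m]_y
    (shell (y *m orthonormal_frame F)%R)%:E); last first.
  by apply/funext => F /=; rewrite section_measureB.
apply: (@measurable_Gr_integral R n k _ _ id (fun z => (shell z.2)%:E)) => //.
  apply/measurable_EFinP.
  exact: measurableT_comp (measurable_shell_density mK mL mg) measurable_snd.
by move=> z; rewrite lee_fin shell_density_ge0.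
Qed.

Let kappa : R := fine (ball_moment m k : \bar R).

Let kappaE : ball_moment m k = kappa%:E.
Proof. by rewrite fineK// ge0_fin_numE ?ball_moment_lty// ltW// ball_moment_gt0. Qed.

Let kappa_gt0 : (0 < kappa)%R.
Proof. by rewrite fine_gt0// ball_moment_gt0// ball_moment_lty. Qed.

Let C : R := (M * (M * omega R m)^-1 `^ (n%:R / m%:R))%R.

Let C_gt0 : (0 < C)%R.
Proof. by rewrite mulr_gt0// powR_gt0// invr_gt0 mulr_gt0// omega_gt0. Qed.

Lemma shell_section_le_moment F :
  (C * kappa * shell_section F `^ (n%:R / m%:R))%R%:E <= moment_integral h F.
Proof.
have mO : measurable_fun setT (fun y : 'rV[R]_m => (y *m orthonormal_frame F)%R).
  by apply: measurable_mxM; [exact: measurable_id|exact: measurable_cst].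
have := @bathtub R m k M (shell_section F) (fun y => shell (y *m orthonormal_frame F)%R)
  m0 k0 g_norm (measurableT_comp (measurable_shell_density mK mL mg) mO)
  (fun=> shell_density_ge0 K L g0 _)
  (esym (section_measureB mK mL bK LK mg g0 g_bounded F)).
apply: le_trans; rewrite kappaE mkn -EFinM lee_fin.
rewrite [X in (_ <= M * X * _)%R](_ : _ = ((M * omega R m)^-1 `^ (n%:R / m%:R) *
    shell_section F `^ (n%:R / m%:R))%R).
  by rewrite le_eqVlt; apply/orP; left; apply/eqP; rewrite /C; ring.
rewrite mulrC powRM//; first by rewrite invr_ge0 mulr_ge0// ltW// omega_gt0.
exact: shell_section_ge0.
Qed.

(** In the hypothesis the moment of the unit ball occurs on both sides, through
    [kappa] and through [ball_moment m k], and cancels.  [J] is the mean of the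
    powers of the sections for a Haar probability, or the power of their infimum. *)
Lemma slicing_of_moment_bound (J : R) : (0 <= J)%R ->
  (C * kappa * J)%R%:E * (omega R n)%:E <= shell_mass%:E * ball_moment m k ->
  (c_pow_k R n k * (1 / M `^ (k%:R / n%:R)) * J `^ (m%:R / n%:R) <=
   shell_mass `^ (m%:R / n%:R))%R.
Proof.
move=> J0; rewrite kappaE -!EFinM lee_fin => bound.
apply: (@powR_scaling n m k) => //; rewrite ?omega_gt0//.
rewrite -(ler_pM2r kappa_gt0); apply: le_trans bound.
by rewrite le_eqVlt; apply/orP; left; apply/eqP; rewrite /C; ring.
Qed.

Lemma slicing_haar (nu : probability (Gr R n k) R) : is_haar nu ->
  (c_pow_k R n k * (1 / M `^ (k%:R / n%:R)) *
    (\int[nu]_F shell_section F `^ (n%:R / m%:R)) `^ (m%:R / n%:R) <=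
   shell_mass `^ (m%:R / n%:R))%R.
Proof.
move=> haar; pose S F := (shell_section F `^ (n%:R / m%:R))%R.
have S0 F : (0 <= S F)%R by exact: powR_ge0.
have mS : measurable_fun setT S.
  apply: (@measurableT_comp _ _ _ _ R R (fun t => t `^ (n%:R / m%:R))%R).
    exact: measurable_powR.
  exact: measurable_shell_section.
have Ck0 : (0 < C * kappa)%R by rewrite mulr_gt0.
have moment_le : (C * kappa)%:E * \int[nu]_F (S F)%:E <= \int[nu]_F moment_integral h F.
  rewrite -ge0_integralZl//; last 3 first.
  - exact/measurable_EFinP.
  - by move=> F _; rewrite lee_fin.
  - by rewrite lee_fin ltW.
  apply: ge0_le_integral => //.
  - by move=> F _; rewrite mule_ge0// lee_fin// ltW.
  - by apply: emeasurable_funM => //; exact/measurable_EFinP.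
  - exact: measurable_moment_integral.
  - by move=> F _; rewrite -EFinM; exact: shell_section_le_moment.
have haarE := integral_haar_moment k0 kn mh h0 haar.
rewrite integral_h in haarE.
have bound : (C * kappa)%:E * \int[nu]_F (S F)%:E * (omega R n)%:E <=
    shell_mass%:E * ball_moment m k.
  by rewrite -haarE lee_wpmul2r// lee_fin ltW// omega_gt0.
have finS : \int[nu]_F (S F)%:E \is a fin_num.
  rewrite ge0_fin_numE; last by apply: integral_ge0 => F _; rewrite lee_fin.
  rewrite ltey; apply/eqP => Soo; move: bound.
  by rewrite Soo gt0_muley ?lte_fin// gt0_mulye ?lte_fin ?omega_gt0// kappaE -EFinM leye_eq.
apply: slicing_of_moment_bound.
  by apply: fine_ge0; apply: integral_ge0 => F _; rewrite lee_fin powR_ge0.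
by rewrite EFinM /Rintegral fineK.
Qed.

(** All the rotated copies of one subspace satisfy the bound by the infimum, and
    the average of their moments is known without a Haar probability. *)
Lemma slicing_inf :
  (c_pow_k R n k * (1 / M `^ (k%:R / n%:R)) * inf (range shell_section) <=
   shell_mass `^ (m%:R / n%:R))%R.
Proof.
pose I := inf (range shell_section).
have I_le F : (I <= shell_section F)%R.
  apply: ge_inf; last by exists F.
  by exists 0%R => _ [G _ <-]; exact: shell_section_ge0.
have I0 : (0 <= I)%R.
  apply: lb_le_inf; first by exists (shell_section point), point.
  by move=> _ [G _ <-]; exact: shell_section_ge0.
have nR : (n%:R != 0 :> R)%R by rewrite pnatr_eq0 -lt0n.
have mR : (m%:R != 0 :> R)%R by rewrite pnatr_eq0 -lt0n.
have -> : inf (range shell_section) = ((I `^ (n%:R / m%:R)) `^ (m%:R / n%:R))%R.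
  rewrite -powRrM (_ : n%:R / m%:R * (m%:R / n%:R) = 1)%R ?powRr1//.
  by field; rewrite nR mR.
apply: slicing_of_moment_bound; first exact: powR_ge0.
have mass_fin : (rotation_mass n : \bar R) \is a fin_num.
  by rewrite ge0_fin_numE ?rotation_mass_lty// ltW// rotation_mass_gt0.
have mass_pos : (0 < fine (rotation_mass n : \bar R))%R.
  by rewrite fine_gt0// rotation_mass_lty rotation_mass_gt0.
rewrite -(@lee_pmul2l _ (rotation_mass n)) ?rotation_mass_gt0//.
rewrite [leRHS]muleA -integral_h -(average_rotated_moment k0 kn mh h0 point).
rewrite muleA; apply: lee_wpmul2r; first by rewrite lee_fin ltW// omega_gt0.
rewrite /rotation_mass -ge0_integralZr//; last 3 first.
- exact: measurable_rotation_weight.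
- by move=> v _; exact: rotation_weight_ge0.
- by rewrite lee_fin !mulr_ge0 ?powR_ge0// ltW.
apply: ge0_le_integral => //.
- move=> v _; rewrite mule_ge0 ?rotation_weight_ge0// lee_fin.
  by rewrite !mulr_ge0 ?powR_ge0// ltW.
- by apply: emeasurable_funM => //; exact: measurable_rotation_weight.
- exact: measurableT_comp (measurable_rotated_moment mh h0) (measurable_pair2 point).
move=> v _; apply: lee_wpmul2l; first exact: rotation_weight_ge0.
apply: le_trans (shell_section_le_moment _); rewrite lee_fin ler_wpM2l//.
  by rewrite mulr_ge0// ltW.
by apply: ge0_ler_powR; rewrite ?nnegrE// shell_section_ge0.
Qed.

End moments.

End slicing.

Theorem theorem1p8 (R : realType) (n k : nat) (hk : (1 <= k)%N) (hkn : (k < n)%N)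
    (K L : set 'rV[R]_n) (mK : measurable K) (mL : measurable L)
    (bK : bounded_set K) (bL : bounded_set L) (LK : L `<=` K)
    (g : 'rV[R]_n -> R) (mg : measurable_fun setT g)
    (g_ge0 : forall x, 0 <= g x) (g_bounded : exists M : R, forall x, g x <= M)
    (g_norm : 0 < Linf_norm g) :
  (forall nu : probability (Gr R n k) R, is_haar nu ->
    (density_measure g K - density_measure g L) `^ ((n - k)%N%:R / n%:R) >=
      c_pow_k R n k * (1 / Linf_norm g `^ (k%:R / n%:R)) *
      (\int[nu]_F (section_measure g K F - section_measure g L F)
         `^ (n%:R / (n - k)%N%:R)) `^ ((n - k)%N%:R / n%:R)) /\
  (density_measure g K - density_measure g L) `^ ((n - k)%N%:R / n%:R) >=
    c_pow_k R n k * (1 / Linf_norm g `^ (k%:R / n%:R)) *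
    inf (range (fun F : Gr R n k =>
      section_measure g K F - section_measure g L F)).
Proof.
split=> [nu haar|].
  exact: (slicing_haar hk hkn mK mL bK LK mg g_ge0 g_bounded g_norm haar).
exact: (slicing_inf hk hkn mK mL bK LK mg g_ge0 g_bounded g_norm).
Qed.
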